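(* The sesqui-linear forms $\mathfrak t$ and $\mathfrak t_G$ are different: $\mathfrak t$ is not the restriction of $\mathfrak t_G$ to $\mathfrak D\times\mathfrak D$ (indeed $\mathfrak t_G$ is bounded whereas $\mathfrak t$ is not).
   Context: Work in $L^2(\mathbb{R})$ with $(f,g)=\int\overline{f}g\,dx$; $q$ is multiplication by $x$, $p=-i\,d/dx$, $t=q^{-1}p$ with $D(t)=\{f\in D(p):pf\in D(q^{-1})\}$, $t^*$ its adjoint; $L^2_0$, $L^2_1$ the even/odd subspaces. Define $S$ in $L^2_0$ by $D(S)=\{f\in L^2_0\cap\bigcap_nD(t^{2n+1}):\sum_{n=0}^N\frac{(-1)^n}{2n+1}t^{2n+1}f$ converges in norm$\}$, $Sf=-\sum_{n\ge0}\frac{(-1)^n}{2n+1}t^{2n+1}f$, and $S^*$ (notation only) in $L^2_1$ by the same formulas with $t^*$ and $L^2_1$. Let $\mathfrak D=D(S)\oplus D(S^* )$ and $\mathfrak t[\psi_0\oplus\psi_1,\phi_0\oplus\phi_1]=\frac12((\psi_0,S\phi_0)+(S\psi_0,\phi_0))+\frac12((\psi_1,S^*\phi_1)+(S^*\psi_1,\phi_1))$ on $\mathfrak D\times\mathfrak D$. Let $h=\frac12(p^2+q^2)$ and $e_n$ ($n\ge0$) its normalized eigenvectors, $he_n=(n+\frac12)e_n$, namely $e_n=c_nH_n(x)e^{-x^2/2}$ with $H_n$ the Hermite polynomials and $c_n>0$. For $t\in[0,2\pi]$ and $N\ge0$ let $\varphi^{(N)}_t=\sum_{n=0}^Ne^{-ith}e_n$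 and $P^{(N)}_t=\frac1{2\pi}(\varphi_t^{(N)},\cdot)\varphi^{(N)}_t$. For all $f,g\in L^2(\mathbb R)$ the limit $\lim_{N\to\infty}\int_0^{2\pi}t\,(f,P^{(N)}_tg)\,dt$ exists and equals $(f,T_Gg)$ for a unique bounded self-adjoint operator $T_G$. Define $\mathfrak t_G[\phi,\psi]=\frac12((\phi,T_G\psi)+(T_G\phi,\psi))$ on $L^2(\mathbb R)\times L^2(\mathbb R)$. *)

(* Defs.v *)
From HB Require Import structures.
From mathcomp Require Import all_boot all_order all_algebra.
From mathcomp Require Import complex.
From mathcomp Require Import all_classical all_reals all_analysis.
From Stdlib Require Import ClassicalEpsilon.

Set Implicit Arguments.
Unset Strict Implicit.
Unset Printing Implicit Defensive.
Import Order.TTheory GRing.Theory Num.Theory.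
Import numFieldNormedType.Exports.
Local Open Scope classical_set_scope.
Local Open Scope ring_scope.

Section Defs.
Variable R : realType.
Local Notation C := R[i].
Local Notation mu := (@lebesgue_measure R).

Definition sqn (z : C) : R := complex.Re z ^+ 2 + complex.Im z ^+ 2.
Definition modc (z : C) : R := Num.sqrt (sqn z).

Definition cint (D : set R) (f : R -> C) : C :=
  Complex (Rintegral mu D (fun x => complex.Re (f x))) (Rintegral mu D (fun x => complex.Im (f x))).

Definition cmeas (f : R -> C) : Prop :=
  measurable_fun setT (fun x => complex.Re (f x)) /\ measurable_fun setT (fun x => complex.Im (f x)).

Definition L2 (f : R -> C) : Prop :=
  cmeas f /\ mu.-integrable setT (fun x => (sqn (f x))%:E).

Definition inner (f g : R -> C) : C := cint setT (fun x => (conjc (f x)) * g x).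

Definition norm2 (f : R -> C) : R := Num.sqrt (Rintegral mu setT (fun x => sqn (f x))).

Definition aeeq (f g : R -> C) : Prop := {ae mu, forall x, f x = g x}.

Definition prim (g : R -> C) (x : R) : C :=
  if 0 <= x then cint [set y | 0 <= y <= x] g else - cint [set y | x <= y <= 0] g.

(* is_p f h : f \in D(p) and p f = h, where p = -i d/dx; D(p) = the L^2 functions
   having an absolutely continuous representative with derivative in L^2. *)
Definition is_p (f h : R -> C) : Prop :=
  L2 f /\ L2 h /\ exists c : C, aeeq f (fun x => c + prim (fun y => 'i%C * h y) x).

Definition is_qinv (g h : R -> C) : Prop :=
  L2 g /\ L2 h /\ aeeq h (fun x => g x / (x%:C)%C).

Definition is_t (f h : R -> C) : Prop := exists g, is_p f g /\ is_qinv g h.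

Definition is_tadj (g k : R -> C) : Prop :=
  L2 g /\ L2 k /\ forall f h, is_t f h -> inner g h = inner k f.

Fixpoint tpow (T : (R -> C) -> (R -> C) -> Prop) (n : nat) (f h : R -> C) : Prop :=
  match n with
  | 0 => L2 f /\ aeeq f h
  | n'.+1 => exists g, tpow T n' f g /\ T g h
  end.

Definition is_even (f : R -> C) : Prop := aeeq (fun x => f (- x)) f.
Definition is_odd (f : R -> C) : Prop := aeeq (fun x => f (- x)) (fun x => - f x).

(* isS T par f s : f \in D(S_T) and S_T f = s, where
   S_T f = - \sum_n (-1)^n/(2n+1) T^{2n+1} f (norm convergent),
   f in the parity subspace par. *)
Definition isS (T : (R -> C) -> (R -> C) -> Prop) (par : (R -> C) -> Prop)
    (f s : R -> C) : Prop :=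
  par f /\ L2 s /\
  exists a : nat -> R -> C,
    (forall n, tpow T n.*2.+1 f (a n)) /\
    (fun N => norm2 (fun x => s x +
        \sum_(0 <= n < N.+1) ((-1) ^+ n / (n.*2.+1)%:R : C) * a n x)) @ \oo --> (0 : R).

Definition Sop (T : (R -> C) -> (R -> C) -> Prop) (par : (R -> C) -> Prop)
    (f : R -> C) : R -> C :=
  epsilon (inhabits (fun _ : R => 0 : C)) (fun s => isS T par f s).

Definition S := Sop is_t is_even.
Definition Sstar := Sop is_tadj is_odd.

Definition evp (f : R -> C) : R -> C := fun x => (f x + f (- x)) / 2.
Definition odp (f : R -> C) : R -> C := fun x => (f x - f (- x)) / 2.

(* psi \in \mathfrak D = D(S) (+) D(S^* ) *)
Definition inD (psi : R -> C) : Prop :=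
  (exists s, isS is_t is_even (evp psi) s) /\ (exists s, isS is_tadj is_odd (odp psi) s).

Definition tform (psi phi : R -> C) : C :=
  (inner (evp psi) (S (evp phi)) + inner (S (evp psi)) (evp phi)) / 2 +
  (inner (odp psi) (Sstar (odp phi)) + inner (Sstar (odp psi)) (odp phi)) / 2.

(* herm2 n x = (H_n x, H_{n+1} x), physicists' Hermite polynomials *)
Fixpoint herm2 (n : nat) (x : R) : R * R :=
  match n with
  | 0 => (1, 2 * x)
  | n'.+1 => let: (a, b) := herm2 n' x in (b, 2 * x * b - (n'.+1).*2%:R * a)
  end.
Definition hermite (n : nat) (x : R) : R := (herm2 n x).1.
Definition hcoef (n : nat) : R := (Num.sqrt (2 ^+ n * n`!%:R * Num.sqrt pi))^-1.
Definition hermf (n : nat) (x : R) : R := hcoef n * hermite n x * expR (- (x ^+ 2) / 2).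

(* phi^{(N)}_t = \sum_{n<=N} e^{-ith} e_n = \sum_{n<=N} e^{-it(n+1/2)} e_n *)
Definition phiN (N : nat) (t : R) : R -> C := fun x =>
  \sum_(0 <= n < N.+1)
     Complex (cos (t * (n%:R + 2^-1))) (- sin (t * (n%:R + 2^-1))) * ((hermf n x)%:C)%C.

Definition PN_form (N : nat) (t : R) (f g : R -> C) : C :=
  (((2 * pi)^-1)%:C)%C * (inner (phiN N t) g * inner f (phiN N t)).

Definition GN (f g : R -> C) (N : nat) : C :=
  cint [set t | 0 <= t <= 2 * pi] (fun t => (t%:C)%C * PN_form N t f g).

(* LG f g = lim_N \int_0^{2pi} t (f, P^{(N)}_t g) dt = (f, T_G g) *)
Definition LG (f g : R -> C) : C :=
  Complex (limn (fun N => complex.Re (GN f g N))) (limn (fun N => complex.Im (GN f g N))).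

(* t_G[phi,psi] = 1/2((phi,T_G psi) + (T_G phi, psi)), (T_G phi,psi) = conj (psi, T_G phi) *)
Definition tG (phi psi : R -> C) : C := (LG phi psi + conjc (LG psi phi)) / 2.

End Defs.

(* Main.v *)
(** The Gaussian [phi_c = exp(- c x^2 / 2)] is an eigenvector of [t] for the eigenvalue [i c],
    so for [0 < c < 1] it lies in [D(S)] and [S phi_c = - i artanh(c) phi_c].  Hence
    [t[phi_b, phi_c] = i (artanh b - artanh c) (phi_b, phi_c) / 2], which is unbounded as [c -> 1]
    with [b = 1/2], while the norms stay bounded and [(phi_b, phi_c)] stays away from [0].
    Since [S] is only given by its graph, one needs that [t] is single valued up to null sets; this
    is Lebesgue's differentiation theorem.

    For [t_G], write [A(t) = (phi^N_t, g)] and [B(t) = (f, phi^N_t)].  The weight [t / 2pi] is at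
    most [1] on [[0, 2pi]], and the orthogonality of the exponentials with Bessel's inequality for
    the Hermite functions gives [int |A|^2 <= 2pi |g|^2] and [int |B|^2 <= 2pi |f|^2], so
    Cauchy-Schwarz bounds the integrals defining [t_G] uniformly in [N].

    A bounded form and an unbounded one cannot agree on [D x D]. *)
Require Import Defs.
From HB Require Import structures.
From mathcomp Require Import all_boot all_order all_algebra.
From mathcomp Require Import complex.
From mathcomp Require Import all_classical all_reals all_analysis measurable_realfun.
From mathcomp Require Import ring lra.
Import Order.TTheory GRing.Theory Num.Theory.
Import numFieldNormedType.Exports.
Local Open Scope classical_set_scope.
Local Open Scope ring_scope.
Set Implicit Arguments.
Unset Strict Implicit.
Unset Printing Implicit Defensive.

(** * Real integrals, square-integrable functions and Bessel's inequality *)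

Section RealIntegral.
Variable R : realType.
Local Notation mu := (@lebesgue_measure R).
Implicit Types (D : set R) (f g : R -> R).

Definition rint D f : R := Rintegral mu D f.
Definition intg D f : Prop := mu.-integrable D (EFin \o f).

Lemma intgD D f g : measurable D -> intg D f -> intg D g ->
  intg D (fun x => f x + g x).
Proof. by move=> mD; exact: integrableD. Qed.

Lemma intgZ D k f : measurable D -> intg D f -> intg D (fun x => k * f x).
Proof. by move=> mD; exact: integrableZl. Qed.

Lemma intgB D f g : measurable D -> intg D f -> intg D g ->
  intg D (fun x => f x - g x).
Proof. by move=> mD; exact: integrableB. Qed.

Lemma intg0 D : intg D (fun=> 0).
Proof. exact: integrable0. Qed.

Lemma intg_sum D (F : nat -> R -> R) N : measurable D -> (forall n, intg D (F n)) ->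
  intg D (fun x => \sum_(0 <= n < N) F n x).
Proof.
move=> mD iF; elim: N => [|N IH].
  by under [X in intg _ X]eq_fun do rewrite big_geq//; exact: intg0.
by under [X in intg _ X]eq_fun do rewrite big_nat_recr//=; exact: intgD.
Qed.

Lemma rint0 D : rint D (fun=> 0) = 0.
Proof. by rewrite /rint/Rintegral integral0. Qed.

Lemma rintD D f g : measurable D -> intg D f -> intg D g ->
  rint D (fun x => f x + g x) = rint D f + rint D g.
Proof. by move=> mD; exact: RintegralD. Qed.

Lemma rintB D f g : measurable D -> intg D f -> intg D g ->
  rint D (fun x => f x - g x) = rint D f - rint D g.
Proof. by move=> mD; exact: RintegralB. Qed.

Lemma rintZ D k f : measurable D -> intg D f ->
  rint D (fun x => k * f x) = k * rint D f.
Proof. by move=> mD; exact: RintegralZl. Qed.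

Lemma rint_sum D (F : nat -> R -> R) N : measurable D -> (forall n, intg D (F n)) ->
  rint D (fun x => \sum_(0 <= n < N) F n x) = \sum_(0 <= n < N) rint D (F n).
Proof.
move=> mD iF; elim: N => [|N IH].
  by under [X in rint _ X]eq_fun do rewrite big_geq//; rewrite rint0 big_geq.
under [X in rint _ X]eq_fun do rewrite big_nat_recr//=.
by rewrite rintD// ?IH ?big_nat_recr//; exact: intg_sum.
Qed.

Lemma rint_ge0 D f : (forall x, 0 <= f x) -> 0 <= rint D f.
Proof. by move=> f0; exact: Rintegral_ge0. Qed.

Lemma le_rint D f g : measurable D -> intg D f -> intg D g ->
  (forall x, D x -> f x <= g x) -> rint D f <= rint D g.
Proof. by move=> mD fi gi fg; apply: le_Rintegral. Qed.

Lemma le_intg D f g : measurable D -> measurable_fun D f ->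
  (forall x, D x -> `|f x| <= g x) -> intg D g -> intg D f.
Proof.
move=> mD mf fg ig; apply: le_integrable ig => //.
  exact/measurable_EFinP.
by move=> x Dx /=; rewrite lee_fin (le_trans (fg x Dx))// ler_norm.
Qed.

Lemma measurable_intg D f : intg D f -> measurable_fun D f.
Proof. by move=> /measurable_int/measurable_EFinP. Qed.

Lemma intg_continuous a b f : continuous f -> intg `[a, b] f.
Proof.
move=> cf; apply: continuous_compact_integrable; first exact: segment_compact.
exact: continuous_subspaceT.
Qed.

Definition sqint f : Prop := measurable_fun setT f /\ intg setT (fun x => f x ^+ 2).

Lemma sqint_mul f g : sqint f -> sqint g -> intg setT (fun x => f x * g x).
Proof.
move=> [mf f2] [mg g2].
apply: (@le_intg setT (fun x => f x * g x) (fun x => f x ^+ 2 + g x ^+ 2)) => //.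
- exact: measurable_funM.
- move=> x _ /=; rewrite normrM -(real_normK (num_real (f x))) -(real_normK (num_real (g x))).
  have := sqr_ge0 (`|f x| - `|g x|); have := normr_ge0 (f x); have := normr_ge0 (g x).
  nra.
- exact: intgD.
Qed.

Lemma sqintD f g : sqint f -> sqint g -> sqint (fun x => f x + g x).
Proof.
move=> sf sg; split; first by apply: measurable_funD; [case: sf|case: sg].
rewrite (_ : (fun x => _) = fun x => (f x ^+ 2 + g x ^+ 2) + 2 * (f x * g x)); last first.
  by apply/funext => x; ring.
apply: intgD => //; first by apply: intgD => //; [case: sf|case: sg].
by apply: intgZ => //; exact: sqint_mul.
Qed.

Lemma sqintZ k f : sqint f -> sqint (fun x => k * f x).
Proof.
move=> [mf sf]; split; first exact: measurable_funM.
under [X in intg _ X]eq_fun do rewrite exprMn.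
exact: intgZ.
Qed.

Lemma sqintB f g : sqint f -> sqint g -> sqint (fun x => f x - g x).
Proof.
move=> sf sg; have := sqintD sf (sqintZ (-1) sg).
by congr sqint; apply/funext => x; ring.
Qed.

Lemma sqint0 : sqint (fun=> 0).
Proof.
split; first exact: measurable_cst.
by under [X in intg _ X]eq_fun do rewrite expr0n; exact: intg0.
Qed.

(** The constant [1] is integrable on a bounded interval and [|f| <= 1 + f^2]. *)
Lemma sqint_intg_itv f a b : sqint f -> intg `[a, b] f.
Proof.
move=> [mf f2]; apply: (@le_intg `[a, b] f (fun x => 1 + f x ^+ 2)) => //.
- exact: measurable_funS mf.
- move=> x _; rewrite -(real_normK (num_real (f x))).
  have := sqr_ge0 (`|f x| - 1); have := normr_ge0 (f x); nra.
- apply: intgD => //; first by apply: intg_continuous => x; exact: cvg_cst.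
  by apply: integrableS f2.
Qed.

(** Let [s] be the projection of [g] onto the first [N] vectors. Orthonormality gives
    [(s, s) = (s, g)], both equal to the sum of the squared coefficients, and expanding
    [0 <= |g - s|^2] yields the bound. *)
Lemma bessel (e : nat -> R -> R) g N :
  (forall n, sqint (e n)) ->
  (forall n m, rint setT (fun x => e n x * e m x) = (n == m)%:R) -> sqint g ->
  \sum_(0 <= n < N) rint setT (fun x => e n x * g x) ^+ 2
    <= rint setT (fun x => g x ^+ 2).
Proof.
move=> se orth sg.
pose a n := rint setT (fun x => e n x * g x).
pose s N x := \sum_(0 <= n < N) a n * e n x.
have ss M : sqint (s M).
  elim: M => [|M IH].
    by rewrite (_ : s 0%N = fun=> 0); [exact: sqint0|apply/funext => x; rewrite /s big_geq].
  rewrite (_ : s M.+1 = fun x => s M x + a M * e M x).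
    by apply: sqintD => //; exact: sqintZ.
  by apply/funext => x; rewrite /s big_nat_recr.
have es n M : rint setT (fun x => e n x * s M x) = if (n < M)%N then a n else 0.
  under [X in rint _ X]eq_fun do rewrite /s big_distrr/=.
  rewrite rint_sum//; last first.
    move=> k; under [X in intg _ X]eq_fun do rewrite mulrCA.
    by apply: intgZ => //; exact: sqint_mul.
  under eq_bigr => k _.
    rewrite (_ : rint _ _ = a k * (n == k)%:R); last first.
      under [X in rint _ X]eq_fun do rewrite mulrCA.
      by rewrite rintZ ?orth//; exact: sqint_mul.
    over.
  case: ifP => nM.
    rewrite (bigD1_seq n) ?mem_index_iota ?iota_uniq//= eqxx mulr1 big1 ?addr0//.
    by move=> i /negPf; rewrite eq_sym => ->; rewrite mulr0.
  rewrite big_nat_cond big1// => i /andP[/andP[_ iM] _].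
  by case: eqP => [ni|]; rewrite ?mulr0//; move: nM; rewrite ni iM.
have ss2 : rint setT (fun x => s N x * s N x) = \sum_(0 <= n < N) a n ^+ 2.
  under [X in rint _ X]eq_fun do rewrite {1}/s big_distrl/=.
  have sm := ss N.
  rewrite rint_sum//; last first.
    move=> k; under [X in intg _ X]eq_fun do rewrite -mulrA.
    by apply: intgZ => //; exact: sqint_mul.
  rewrite !big_nat; apply: eq_bigr => i iN.
  under [X in rint _ X]eq_fun do rewrite -mulrA.
  by rewrite rintZ//; [rewrite es (andP iN).2 -expr2|exact: sqint_mul].
have sgN : rint setT (fun x => s N x * g x) = \sum_(0 <= n < N) a n ^+ 2.
  under [X in rint _ X]eq_fun do rewrite {1}/s big_distrl/=.
  rewrite rint_sum//; last first.
    move=> k; under [X in intg _ X]eq_fun do rewrite -mulrA.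
    by apply: intgZ => //; exact: sqint_mul.
  rewrite !big_nat; apply: eq_bigr => i iN.
  under [X in rint _ X]eq_fun do rewrite -mulrA.
  by rewrite rintZ//; exact: sqint_mul.
have : 0 <= rint setT (fun x => (g x - s N x) ^+ 2).
  by apply: rint_ge0 => x; exact: sqr_ge0.
rewrite (_ : (fun x => _) = fun x => (g x ^+ 2 + s N x * s N x) - 2 * (s N x * g x)); last first.
  by apply/funext => x; ring.
have sm := ss N; have sg2 := sg.2.
have i1 := sqint_mul sm sm; have i2 := sqint_mul sm sg.
rewrite rintB//; [|exact: intgD|exact: intgZ].
rewrite rintD// rintZ// ss2 sgN; lra.
Qed.

(** Dominated convergence for the truncations of [f] to [[-n, n]], with [|f|] as dominating
    function. *)
Lemma cvg_rint_itv f : intg setT f ->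
  rint `[- n%:R, n%:R] f @[n --> \oo] --> rint setT f.
Proof.
move=> fi; have mf := measurable_intg fi.
pose u (n : nat) := f \_ `[- n%:R, n%:R].
have mu_ n : measurable_fun setT (EFin \o u n).
  apply/measurable_EFinP; rewrite /u; apply/(measurable_restrict f) => //.
  by rewrite setTI; exact: measurable_funS mf.
have uf : {ae mu, forall x, setT x -> (EFin \o u n) x @[n --> \oo] --> (EFin \o f) x}.
  apply: aeW => x _ /=; apply: cvg_near_cst; exists (Num.bound `|x|) => //= n /= hn.
  rewrite /u patchE mem_set//= in_itv/= -ler_norml.
  apply: ltW; apply: lt_le_trans (archi_boundP (normr_ge0 x)) _.
  by rewrite ler_nat.
have ub : {ae mu, forall x n, setT x ->
    (`|(EFin \o u n) x| <= (EFin \o (fun x => `|f x|)%R) x)%E}.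
  apply: aeW => x n _ /=; rewrite lee_fin /u patchE.
  by case: ifP => // _; rewrite normr0.
have [_ _ cv] := dominated_convergence (mu := mu) measurableT mu_ (measurable_int mu fi) uf
  (integrable_norm fi) ub.
move: cv; rewrite -(fineK (integrable_fin_num measurableT fi)) => /fine_cvg.
apply: cvg_trans; rewrite (_ : (fun n => rint _ f) = fun n => rint setT (u n)); first exact: cvg_id.
by apply/funext => n; rewrite /rint Rintegral_mkcond.
Qed.

Lemma rint_derive (f F : R -> R) a b : a < b -> continuous f ->
  (forall x, is_derive x (1 : R) F (f x)) -> rint `[a, b] f = F b - F a.
Proof.
move=> ab cf dF.
have cF x : {for x, continuous F}.
  by apply: differentiable_continuous; apply/derivable1_diffP; case: (dF x).
rewrite /rint /Rintegral (@continuous_FTC2 _ f F)//.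
- exact: continuous_subspaceT.
- split.
  + by move=> x _; case: (dF x).
  + by apply: cvg_at_right_filter; exact: cF.
  + by apply: cvg_at_left_filter; exact: cF.
- by move=> x _; rewrite derive1E; case: (dF x).
Qed.

(** The boundary terms at both infinities vanish. This is what integration by parts against a
    Gaussian needs. *)
Lemma rint_derive0 (f F : R -> R) : continuous f ->
  (forall x, is_derive x (1 : R) F (f x)) -> intg setT f ->
  F n%:R @[n --> \oo] --> 0 -> F (- n%:R) @[n --> \oo] --> 0 ->
  rint setT f = 0.
Proof.
move=> cf dF fi F1 F2.
have h : rint `[- n%:R, n%:R] f @[n --> \oo] --> 0 - 0.
  apply: cvg_trans (cvgB F1 F2); apply: near_eq_cvg.
  (* [n = 0] is excluded because [rint_derive] asks for a nondegenerate interval. *)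
  exists 1%N => //= n n0; rewrite (rint_derive (F := F))//.
  have : 0 < n%:R :> R by rewrite ltr0n.
  lra.
rewrite -[RHS](subrr 0); exact: cvg_unique (cvg_rint_itv fi) h.
Qed.

End RealIntegral.

(** * Gaussians, Hermite polynomials and the orthonormality of the Hermite functions *)

Section Hermite.
Variable R : realType.
Local Notation mu := (@lebesgue_measure R).
Implicit Types (c x : R) (p q : {poly R}).

(** The exponent carries no factor [1/2]: the Hermite weight is [gauss 1], and the eigenvectors of
    [t] are the functions [gauss (c / 2)]. *)
Definition gauss c x : R := expR (- (c * x ^+ 2)).

Lemma gauss_ge0 c x : 0 <= gauss c x.
Proof. exact: expR_ge0. Qed.

Lemma gaussD c d x : gauss (c + d) x = gauss c x * gauss d x.
Proof. by rewrite /gauss -expRD; congr expR; ring. Qed.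

Lemma is_derive_gauss c x : is_derive x (1 : R) (gauss c) (- (2 * c) * (x * gauss c x)).
Proof.
have d : is_derive x (1 : R) (fun y : R => - (c * y ^+ 2)) (- (2 * c) * x).
  apply: is_derive_eq; rewrite /GRing.scale/=; ring.
have h := is_derive1_comp (f := expR) (g := fun y : R => - (c * y ^+ 2)) (is_derive_expR (- (c * x ^+ 2))) d.
by apply: (is_derive_eq h); rewrite /gauss; ring.
Qed.

Lemma continuous_gauss c : continuous (gauss c).
Proof.
move=> x; apply: differentiable_continuous; apply/derivable1_diffP.
by case: (is_derive_gauss c x).
Qed.

Lemma measurable_gauss c : measurable_fun setT (gauss c).
Proof. exact: continuous_measurable_fun (@continuous_gauss c). Qed.

Lemma intg_gauss c : 0 < c -> intg setT (gauss c).
Proof.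
(* With this standard deviation the centred normal density is a constant multiple of [gauss c]. *)
move=> c0; pose s := Num.sqrt ((2 * c)^-1).
have s0 : s != 0 by rewrite sqrtr_eq0 -ltNge invr_gt0 mulr_gt0.
have s2 : s ^+ 2 *+ 2 = c^-1.
  rewrite sqr_sqrtr ?invr_ge0 ?mulr_ge0 ?ltW//.
  by rewrite -mulr_natr; field; rewrite gt_eqF.
have := @integrable_normal_pdf R 0 s.
move=> /(integrableZl measurableT (normal_peak s)^-1).
congr (integrable _ _ _); apply/funext => x /=.
rewrite normal_pdfE// /normal_fun -EFinM; congr EFin.
rewrite mulrA mulVf ?mul1r; last by rewrite gt_eqF// normal_peak_gt0.
by rewrite /gauss; congr expR; rewrite subr0 s2; field; rewrite gt_eqF.
Qed.

(* A factor [|x|] is absorbed by the Gaussian since [1 + y <= expR y]. *)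
Lemma monomial_gauss_bounded k c : 0 < c ->
  exists2 C : R, 0 <= C & forall x, `|x| ^+ k * gauss c x <= C.
Proof.
elim: k c => [|k IH] c c0.
  exists 1 => // x; rewrite expr0 mul1r /gauss expR_le1 oppr_le0.
  by rewrite mulr_ge0 ?sqr_ge0 ?ltW.
have [C C0 hC] := IH (c / 2) (divr_gt0 c0 (ltr0Sn _ 1)).
exists ((1 + 2 / c) * C) => [|x].
  by rewrite mulr_ge0// addr_ge0// divr_ge0 ?ltW.
rewrite [c in gauss c]splitr gaussD exprS mulrACA ler_pM//.
- by rewrite mulr_ge0 ?gauss_ge0.
- by rewrite mulr_ge0 ?exprn_ge0 ?gauss_ge0.
rewrite /gauss expRN ler_pdivrMr ?expR_gt0//.
have := expR_ge1Dx (c / 2 * x ^+ 2); set e := expR _ => h.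
apply: le_trans (ler_wpM2l _ h); last by rewrite addr_ge0// divr_ge0 ?ltW.
rewrite (_ : (1 + 2 / c) * _ = 1 + c / 2 * x ^+ 2 + 2 / c + x ^+ 2); last first.
  by field; rewrite gt_eqF.
rewrite -(real_normK (num_real x)).
have := sqr_ge0 (`|x| - 1); have : 0 <= 2 / c by rewrite divr_ge0 ?ltW.
have : 0 <= c / 2 * `|x| ^+ 2 by rewrite mulr_ge0 ?sqr_ge0// divr_ge0 ?ltW.
nra.
Qed.

(** Induction along [p * 'X + a]: one half of the exponent absorbs the new factor [x], the other
    half goes to the induction hypothesis, which is why [c] stays general. *)
Lemma poly_gauss_bounded p c : 0 < c ->
  exists2 C : R, 0 <= C & forall x, `|p.[x] * gauss c x| <= C.
Proof.
move=> c0; elim/poly_ind: p c c0 => [|p a IH] c c0.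
  by exists 0 => // x; rewrite horner0 mul0r normr0.
have c20 := divr_gt0 c0 (ltr0Sn R 1).
have [C C0 hC] := IH _ c20; have [D D0 hD] := monomial_gauss_bounded 1 c20.
have [E E0 hE] := monomial_gauss_bounded 0 c0.
exists (C * D + `|a| * E) => [|x].
  by rewrite addr_ge0// mulr_ge0.
rewrite hornerMXaddC mulrDl (le_trans (ler_normD _ _))// lerD//.
  rewrite {1}[c in gauss c]splitr gaussD mulrACA normrM ler_pM//.
  by have := hD x; rewrite expr1 normrM (ger0_norm (gauss_ge0 _ _)).
rewrite normrM ler_wpM2l//.
by have := hE x; rewrite expr0 mul1r (ger0_norm (gauss_ge0 _ _)).
Qed.

Lemma continuous_horner p : continuous (horner p).
Proof.
move=> x; apply: differentiable_continuous; apply/derivable1_diffP.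
exact: derivable_horner.
Qed.

Lemma continuous_poly_gauss p c : continuous (fun x => p.[x] * gauss c x).
Proof.
by move=> x; apply: (@cvgM _ _ _ _ (horner p) (gauss c)); [exact: continuous_horner|exact: continuous_gauss].
Qed.

(** One half of the exponent bounds the polynomial and the other half is the integrable majorant. *)
Lemma intg_poly_gauss p c : 0 < c -> intg setT (fun x => p.[x] * gauss c x).
Proof.
move=> c0; have c20 := divr_gt0 c0 (ltr0Sn R 1).
have [C C0 hC] := poly_gauss_bounded p c20.
apply: (@le_intg _ setT _ (fun x => C * gauss (c / 2) x)) => //.
- exact: continuous_measurable_fun (@continuous_poly_gauss p c).
- move=> x _; rewrite [c in gauss c]splitr gaussD mulrA normrM.
  by rewrite (ger0_norm (gauss_ge0 _ _)) ler_wpM2r ?gauss_ge0.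
- by apply: intgZ => //; exact: intg_gauss.
Qed.

(** Boundedness for [p * 'X] makes the values at [u n] at most [C / n]. The sequences of interest
    are [n] and [-n]. *)
Lemma cvg_poly_gauss p c (u : nat -> R) : 0 < c -> (forall n, `|u n| = n%:R) ->
  p.[u n] * gauss c (u n) @[n --> \oo] --> 0.
Proof.
move=> c0 un.
have [C C0 hC] := poly_gauss_bounded (p * 'X) c0.
apply/cvgrPdist_le => /= e e0; near=> n.
have n0 : 0 < n%:R :> R by rewrite ltr0n; near: n; exists 1%N.
rewrite sub0r normrN -(ler_pM2r n0) -(un n) -normrM mulrAC.
rewrite -hornerMX (le_trans (hC _))// un -ler_pdivrMl//.
near: n; exact: nbhs_infty_ger.
Unshelve. all: by end_near. Qed.

Definition gint p : R := rint setT (fun x => p.[x] * gauss 1 x).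

Lemma gintD p q : gint (p + q) = gint p + gint q.
Proof.
rewrite /gint -rintD//; [|exact: intg_poly_gauss|exact: intg_poly_gauss].
by congr rint; apply/funext => x; rewrite hornerD mulrDl.
Qed.

Lemma gintZ a p : gint (a *: p) = a * gint p.
Proof.
rewrite /gint -rintZ//; last exact: intg_poly_gauss.
by congr rint; apply/funext => x; rewrite hornerZ mulrA.
Qed.

Lemma gintB p q : gint (p - q) = gint p - gint q.
Proof. by rewrite gintD -scaleN1r gintZ mulN1r. Qed.

Lemma gint1 : gint 1 = Num.sqrt pi.
Proof.
rewrite /gint /rint /Rintegral (_ : (fun x => _) = fun x => (gauss_fun x)%:E).
  by rewrite integralT_gauss.
by apply/funext => x; rewrite hornerC mul1r /gauss mul1r.
Qed.

(** The derivative of [p exp(- x^2)] is [(p' - 2xp) exp(- x^2)], and its integral over the line is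
    [0]. *)
Lemma gint_deriv p : gint p^`() = gint (2%:P * 'X * p).
Proof.
apply/subr0_eq; rewrite -gintB /gint.
apply: (@rint_derive0 _ _ (fun x => p.[x] * gauss 1 x)).
- exact: continuous_poly_gauss.
- move=> x.
  have dp : is_derive x (1 : R) (horner p) p^`().[x].
    by apply: DeriveDef; [exact: derivable_horner|rewrite -derive1E derivE].
  have dg := is_derive_gauss 1 x.
  apply: is_derive_eq; rewrite /GRing.scale/= !(hornerD, hornerN, hornerM, hornerC, hornerX). ring.
- exact: intg_poly_gauss.
- by apply: cvg_poly_gauss => // n; rewrite normr_nat.
- by apply: cvg_poly_gauss => // n; rewrite normrN normr_nat.
Qed.

(** The recursion of [herm2] lifted to formal polynomials, so that derivatives and products can be
    computed algebraically. *)
Fixpoint hpoly2 (n : nat) : {poly R} * {poly R} :=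
  match n with
  | 0 => (1, 2%:P * 'X)
  | n'.+1 => let: (a, b) := hpoly2 n' in (b, 2%:P * 'X * b - (n'.+1).*2%:R%:P * a)
  end.
Definition hpoly n := (hpoly2 n).1.

Lemma hpoly2E n : hpoly2 n = (hpoly n, hpoly n.+1).
Proof. by rewrite /hpoly /=; case: (hpoly2 n). Qed.

Lemma hpoly0 : hpoly 0 = 1. Proof. by []. Qed.

Lemma hpoly1 : hpoly 1 = 2%:P * 'X. Proof. by []. Qed.

Lemma hpolySS n : hpoly n.+2 = 2%:P * 'X * hpoly n.+1 - (n.+1).*2%:R%:P * hpoly n.
Proof.
rewrite {1}/hpoly (_ : hpoly2 n.+2 = let: (a, b) := hpoly2 n.+1 in
  (b, 2%:P * 'X * b - (n.+2).*2%:R%:P * a))//.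
rewrite (_ : hpoly2 n.+1 = let: (a, b) := hpoly2 n in
  (b, 2%:P * 'X * b - (n.+1).*2%:R%:P * a))//.
by rewrite hpoly2E.
Qed.

Lemma hermite_horner n x : hermite n x = (hpoly n).[x].
Proof.
suff : herm2 n x = ((hpoly n).[x], (hpoly n.+1).[x]) by rewrite /hermite => ->.
elim: n => [|n IH]; first by rewrite /= !hornerE.
by rewrite [LHS]/= IH hpolySS !hornerE.
Qed.

Lemma deriv_hpoly n : (hpoly n.+1)^`() = n.+1.*2%:R%:P * hpoly n.
Proof.
(* The recurrence has order two, so two consecutive indices are carried through the induction. *)
suff : (hpoly n.+1)^`() = n.+1.*2%:R%:P * hpoly n /\
       (hpoly n.+2)^`() = n.+2.*2%:R%:P * hpoly n.+1 by case.
elim: n => [|n [IH1 IH2]].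
  rewrite hpolySS hpoly1 hpoly0.
  rewrite !(derivB, derivM, derivC, derivX, derivE).
  by split; rewrite -!muln2 !natrM ?polyCM !polyC_natr; ring.
split => //; rewrite hpolySS !(derivB, derivM, derivC, derivX) IH2 IH1.
rewrite (hpolySS n) -!muln2 !natrM ?polyCM !polyC_natr.
rewrite -[n.+3]addn1 -[n.+2]addn1 -[n.+1]addn1 !natrD.
ring.
Qed.

Lemma hpolyS n : hpoly n.+1 = 2%:P * 'X * hpoly n - (hpoly n)^`().
Proof.
case: n => [|n]; first by rewrite hpoly1 hpoly0 -polyC1 derivC; ring.
by rewrite hpolySS deriv_hpoly.
Qed.

(* Integrating by parts, [H_(n+1) = 2xH_n - H_n'] makes [H_(n+1)] dual to the derivative. *)
Lemma gint_hpolyS n p : gint (hpoly n.+1 * p) = gint (hpoly n * p^`()).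
Proof.
have h := gint_deriv (hpoly n * p); rewrite derivM gintD in h.
rewrite hpolyS mulrBl gintB -(mulrA (2%:P * 'X)) -h; ring.
Qed.

(** Moving one index onto the other factor as a derivative lowers both by one and produces a factor
    [2(n+1)]. If one index reaches [0] first, the derivative of [1] gives [0]; otherwise the
    integral of [exp(- x^2)] remains. *)
Lemma gint_hpoly n m :
  gint (hpoly n * hpoly m) = (n == m)%:R * (2 ^+ n * n`!%:R * Num.sqrt pi).
Proof.
elim: n m => [|n IH] [|m].
- by rewrite hpoly0 mulr1 gint1 eqxx expr0 fact0 !mul1r.
- by rewrite mulrC gint_hpolyS hpoly0 -polyC1 derivC mulr0 -(scale0r 1) gintZ !mul0r.
- by rewrite gint_hpolyS hpoly0 -polyC1 derivC mulr0 -(scale0r 1) gintZ !mul0r.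
- rewrite gint_hpolyS deriv_hpoly mulrCA mul_polyC gintZ IH eqSS.
  case: eqP => [->|_]; last by rewrite !mul0r mulr0.
  by rewrite exprS factS natrM -muln2 natrM; ring.
Qed.

Lemma hermfE n x : hermf n x = (hcoef R n *: hpoly n).[x] * gauss (2^-1) x.
Proof.
by rewrite /hermf hermite_horner hornerZ; congr (_ * expR _); ring.
Qed.

Lemma hermfM n m x : hermf n x * hermf m x =
  ((hcoef R n *: hpoly n) * (hcoef R m *: hpoly m)).[x] * gauss 1 x.
Proof.
by rewrite hermfE (hermfE m) mulrACA -gaussD -hornerM (_ : 2^-1 + 2^-1 = 1 :> R) //; lra.
Qed.

Lemma sqint_hermf n : sqint (hermf (R := R) n).
Proof.
split.
  rewrite (_ : hermf n = fun x => (hcoef R n *: hpoly n).[x] * gauss (2^-1) x).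
    exact: continuous_measurable_fun (@continuous_poly_gauss _ _).
  by apply/funext => x; exact: hermfE.
rewrite (_ : (fun x => _) = fun x =>
  ((hcoef R n *: hpoly n) * (hcoef R n *: hpoly n)).[x] * gauss 1 x).
  exact: intg_poly_gauss.
by apply/funext => x; rewrite expr2 hermfM.
Qed.

Lemma orthonormal_hermf n m : rint setT (fun x => hermf (R := R) n x * hermf m x) = (n == m)%:R.
Proof.
under [X in rint _ X]eq_fun do rewrite hermfM.
rewrite -[LHS]/(gint _) -scalerAl -scalerAr !gintZ gint_hpoly.
case: eqP => [->|_]; last by rewrite mul0r !mulr0.
rewrite /hcoef mul1r mulrA -invfM -expr2 sqr_sqrtr ?mulVf//.
  by rewrite gt_eqF// !mulr_gt0 ?exprn_gt0 ?ltr0n ?fact_gt0 ?sqrtr_gt0 ?pi_gt0.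
Qed.

End Hermite.

(** * Boundedness of [tG] *)

Section AharonovBohmBound.
Variable R : realType.
Local Notation mu := (@lebesgue_measure R).
Local Notation C := R[i].
Implicit Types (f g : R -> C) (a b : nat -> R).

Lemma innerE f g : inner f g = Complex
  (rint setT (fun x => complex.Re (f x) * complex.Re (g x) + complex.Im (f x) * complex.Im (g x)))
  (rint setT (fun x => complex.Re (f x) * complex.Im (g x) - complex.Im (f x) * complex.Re (g x))).
Proof.
by rewrite /inner /cint /rint; congr Complex; apply: eq_Rintegral => x _;
  case: (f x) (g x) => u v [u' v'] /=; ring.
Qed.

Lemma L2_Re f : L2 f -> sqint (fun x => complex.Re (f x)).
Proof.
move=> [[m1 m2] i]; split => //; apply: (@le_intg _ setT _ (fun x => sqn (f x))) => //.
- exact: measurable_funX.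
- by move=> x _; rewrite ger0_norm ?sqr_ge0// lerDl sqr_ge0.
Qed.

Lemma L2_Im f : L2 f -> sqint (fun x => complex.Im (f x)).
Proof.
move=> [[m1 m2] i]; split => //; apply: (@le_intg _ setT _ (fun x => sqn (f x))) => //.
- exact: measurable_funX.
- by move=> x _; rewrite ger0_norm ?sqr_ge0// lerDr sqr_ge0.
Qed.

Lemma L2P f : sqint (fun x => complex.Re (f x)) -> sqint (fun x => complex.Im (f x)) -> L2 f.
Proof. by move=> [m1 i1] [m2 i2]; split => //; exact: intgD. Qed.

Lemma sqn_ge0 (z : C) : 0 <= sqn z.
Proof. by rewrite addr_ge0 ?sqr_ge0. Qed.

Lemma norm2_sqr f : norm2 f ^+ 2 = rint setT (fun x => sqn (f x)).
Proof. by rewrite sqr_sqrtr//; apply: rint_ge0 => x; exact: sqn_ge0. Qed.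

Lemma norm2_ge0 f : 0 <= norm2 f.
Proof. exact: sqrtr_ge0. Qed.

Lemma inner_conj f g : L2 f -> L2 g -> inner g f = conjc (inner f g).
Proof.
move=> Lf Lg; rewrite !innerE /=; congr Complex.
  by congr rint; apply/funext => x; ring.
have [[fr fi] [gr gi]] := ((L2_Re Lf, L2_Im Lf), (L2_Re Lg, L2_Im Lg)).
rewrite -mulN1r -rintZ//; first by congr rint; apply/funext => x; ring.
by apply: intgB => //; exact: sqint_mul.
Qed.

(** The phase of [e_n] at time [t]. The half cancels in differences of phases, which are integer
    multiples of [t]. *)
Definition theta (n : nat) (t : R) : R := t * (n%:R + 2^-1).

Lemma phiNE N t x : phiN N t x = Complex
  (\sum_(0 <= n < N.+1) cos (theta n t) * hermf n x)
  (- \sum_(0 <= n < N.+1) sin (theta n t) * hermf n x).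
Proof.
rewrite /phiN; elim: N.+1 => [|M IH].
  by rewrite !big_geq// oppr0.
rewrite !big_nat_recr//= IH /theta; apply/eqP; rewrite eq_complex /=.
by apply/andP; split; apply/eqP; ring.
Qed.

(** [tsumRe] and [tsumIm] are the real and imaginary parts of the sum of
    [exp(i theta_n) (a_n + i b_n)]. *)
Definition tsumRe N a b t : R :=
  \sum_(0 <= n < N.+1) (cos (theta n t) * a n - sin (theta n t) * b n).
Definition tsumIm N a b t : R :=
  \sum_(0 <= n < N.+1) (cos (theta n t) * b n + sin (theta n t) * a n).

(** Since [e_n] is real, [hRe] and [hIm] are the real and imaginary parts of the coefficient
    [(e_n, f)]. *)
Definition hRe f n : R := rint setT (fun x => hermf n x * complex.Re (f x)).
Definition hIm f n : R := rint setT (fun x => hermf n x * complex.Im (f x)).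

Lemma rint_hermf_sum N (w : nat -> R) (g : R -> R) : sqint g ->
  intg setT (fun x => (\sum_(0 <= n < N) w n * hermf n x) * g x) /\
  rint setT (fun x => (\sum_(0 <= n < N) w n * hermf n x) * g x) =
  \sum_(0 <= n < N) w n * rint setT (fun x => hermf n x * g x).
Proof.
move=> sg.
have ig n : intg setT (fun x => w n * (hermf n x * g x)).
  by apply: intgZ => //; apply: sqint_mul => //; exact: sqint_hermf.
rewrite (_ : (fun x => _ * g x) = fun x => \sum_(0 <= n < N) w n * (hermf n x * g x)); last first.
  by apply/funext => x; rewrite big_distrl; apply: eq_bigr => n _; rewrite mulrA.
split; first exact: intg_sum.
rewrite rint_sum//; apply: eq_bigr => n _.
by rewrite rintZ//; apply: sqint_mul => //; exact: sqint_hermf.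
Qed.

(** Conjugation in the first argument turns the phases [exp(- i theta_n)] of [phiN] into
    [exp(i theta_n)]. *)
Lemma inner_phiN N t f : L2 f ->
  inner (phiN N t) f = Complex (tsumRe N (hRe f) (hIm f) t) (tsumIm N (hRe f) (hIm f) t).
Proof.
move=> Lf; rewrite innerE.
have := rint_hermf_sum N.+1 (fun n => cos (theta n t)) (L2_Re Lf).
have := rint_hermf_sum N.+1 (fun n => sin (theta n t)) (L2_Im Lf).
have := rint_hermf_sum N.+1 (fun n => cos (theta n t)) (L2_Im Lf).
have := rint_hermf_sum N.+1 (fun n => sin (theta n t)) (L2_Re Lf).
move=> [i4 e4] [i3 e3] [i2 e2] [i1 e1].
congr Complex.
- rewrite /tsumRe sumrB -e1 -e2 -rintB//; congr rint; apply/funext => x.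
  by rewrite phiNE /=; ring.
- rewrite /tsumIm big_split/= -e3 -e4 -rintD//; congr rint; apply/funext => x.
  by rewrite phiNE /=; ring.
Qed.

Lemma bessel_hermf f N : L2 f ->
  \sum_(0 <= n < N) (hRe f n ^+ 2 + hIm f n ^+ 2) <= norm2 f ^+ 2.
Proof.
move=> Lf; rewrite big_split/= norm2_sqr rintD//; [|by case: (L2_Re Lf)|by case: (L2_Im Lf)].
apply: lerD; apply: bessel => //; try exact: sqint_hermf; try exact: orthonormal_hermf.
  exact: L2_Re.
exact: L2_Im.
Qed.

(** * Orthogonality of the exponentials on [[0, 2 pi]] *)

Lemma continuous_theta n : continuous (theta n).
Proof. by move=> t; apply: cvgM; [exact: cvg_id|exact: cvg_cst]. Qed.

Lemma continuous_cos_theta n : continuous (fun t => cos (theta n t)).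
Proof.
by move=> t; apply: (continuous_comp (f := theta n)); [exact: continuous_theta|exact: continuous_cos].
Qed.

Lemma continuous_sin_theta n : continuous (fun t => sin (theta n t)).
Proof.
by move=> t; apply: (continuous_comp (f := theta n)); [exact: continuous_theta|exact: continuous_sin].
Qed.

Lemma continuous_sum_nat (F : nat -> R -> R) N : (forall n, continuous (F n)) ->
  continuous (fun t => \sum_(0 <= n < N) F n t).
Proof.
move=> cF; elim: N => [|N IH].
  by under [X in continuous X]eq_fun do rewrite big_geq//; move=> t; exact: cvg_cst.
under [X in continuous X]eq_fun do rewrite big_nat_recr//=.
by move=> t; apply: cvgD; [exact: IH|exact: cF].
Qed.

Lemma continuous_tsumRe N a b : continuous (tsumRe N a b).
Proof.
apply: continuous_sum_nat => n t.
by apply: cvgB; apply: cvgM; try exact: cvg_cst; [exact: continuous_cos_theta|exact: continuous_sin_theta].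
Qed.

Lemma continuous_tsumIm N a b : continuous (tsumIm N a b).
Proof.
apply: continuous_sum_nat => n t.
by apply: cvgD; apply: cvgM; try exact: cvg_cst; [exact: continuous_cos_theta|exact: continuous_sin_theta].
Qed.

Lemma cos_sin_2pi_nat n : cos (2 * pi * n%:R : R) = 1 /\ sin (2 * pi * n%:R : R) = 0.
Proof.
elim: n => [|n [c s]]; first by rewrite mulr0 cos0 sin0.
rewrite -[n.+1]addn1 natrD mulrDr mulr1 cosD sinD c s [2 * pi]mulrC mulr_natr cos2pi sin2pi.
by split; ring.
Qed.

(** For [n <> m] the phase difference is [k t] with [k] a nonzero integer, and the primitives
    [sin(k t) / k] and [- cos(k t) / k] agree at [0] and [2 pi]. *)
Lemma rint_trig n m :
  rint `[0, 2 * pi] (fun t => cos (theta n t - theta m t)) = (n == m)%:R * (2 * pi) /\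
  rint `[0, 2 * pi] (fun t => sin (theta n t - theta m t)) = 0.
Proof.
have pi0 : 0 < 2 * pi :> R by rewrite mulr_gt0 ?pi_gt0.
have [->|nm] := eqVneq n m.
  under [X in rint _ X = _ /\ _]eq_fun do rewrite subrr cos0.
  under [X in _ /\ rint _ X = _]eq_fun do rewrite subrr sin0.
  rewrite rint0 /rint Rintegral_cst//= lebesgue_measure_itv/= lte_fin pi0.
  by rewrite /= mul1r mul1r subr0.
pose k : R := n%:R - m%:R.
have k0 : k != 0 by rewrite subr_eq0 eqr_nat.
have tE t : theta n t - theta m t = k * t by rewrite /theta /k; ring.
have [cn sn] := cos_sin_2pi_nat n; have [cm sm] := cos_sin_2pi_nat m.
have kE : k * (2 * pi) = 2 * pi * n%:R - 2 * pi * m%:R by rewrite /k; ring.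
have ck : continuous ( *%R k : R -> R) by move=> t; apply: cvgM; [exact: cvg_cst|exact: cvg_id].
under [X in rint _ X = _ /\ _]eq_fun do rewrite tE.
under [X in _ /\ rint _ X = _]eq_fun do rewrite tE.
rewrite mul0r; split.
  have cf : continuous (fun t => cos (k * t)).
    by move=> t; apply: (continuous_comp (f := *%R k)); [exact: ck|exact: continuous_cos].
  have dF t : is_derive t (1 : R) (fun t => k^-1 * sin (k * t)) (cos (k * t)).
    have dk : is_derive t (1 : R) (fun t : R => k * t) k.
      by apply: is_derive_eq; rewrite /GRing.scale/= mulr1.
    have h := is_derive1_comp (f := sin) (g := fun t : R => k * t) (is_derive_sin (k * t)) dk.
    have h2 := is_deriveZ k^-1 h.
    by apply: (is_derive_eq h2); rewrite /GRing.scale/=; field.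
  by rewrite (rint_derive pi0 cf dF) kE sinB cn sn cm sm !mulr0 sin0; ring.
have cf : continuous (fun t => sin (k * t)).
  by move=> t; apply: (continuous_comp (f := *%R k)); [exact: ck|exact: continuous_sin].
have dF t : is_derive t (1 : R) (fun t => - k^-1 * cos (k * t)) (sin (k * t)).
  have dk : is_derive t (1 : R) (fun t : R => k * t) k.
    by apply: is_derive_eq; rewrite /GRing.scale/= mulr1.
  have h := is_derive1_comp (f := cos) (g := fun t : R => k * t) (is_derive_cos (k * t)) dk.
  have h2 := is_deriveZ (- k^-1) h.
  by apply: (is_derive_eq h2); rewrite /GRing.scale/=; field.
by rewrite (rint_derive pi0 cf dF) kE cosB cn sn cm sm !mulr0 cos0; ring.
Qed.

(** Parseval for a finite trigonometric sum: the squared modulus is a double sum whose off-diagonal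
    terms integrate to [0]. *)
Lemma rint_tsum_sqr N a b :
  rint `[0, 2 * pi] (fun t => tsumRe N a b t ^+ 2 + tsumIm N a b t ^+ 2) =
  2 * pi * \sum_(0 <= n < N.+1) (a n ^+ 2 + b n ^+ 2).
Proof.
(* With [z_n = a_n + i b_n], this is the real part of [z_n conj(z_m) exp(i (theta_n - theta_m))]. *)
pose K n m t := (a n * a m + b n * b m) * cos (theta n t - theta m t) +
   (a n * b m - b n * a m) * sin (theta n t - theta m t).
have cd n m : continuous (fun t => theta n t - theta m t).
  by move=> t; apply: cvgB; exact: continuous_theta.
have iC n m : intg `[0, 2 * pi] (fun t => cos (theta n t - theta m t)).
  apply: intg_continuous => t; apply: (continuous_comp (f := fun t => theta n t - theta m t)).
    exact: cd.
  exact: continuous_cos.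
have iS n m : intg `[0, 2 * pi] (fun t => sin (theta n t - theta m t)).
  apply: intg_continuous => t; apply: (continuous_comp (f := fun t => theta n t - theta m t)).
    exact: cd.
  exact: continuous_sin.
have iK n m : intg `[0, 2 * pi] (K n m) by apply: intgD => //; exact: intgZ.
rewrite (_ : (fun t => _) = fun t => \sum_(0 <= n < N.+1) \sum_(0 <= m < N.+1) K n m t).
  rewrite rint_sum//; last by move=> n; exact: intg_sum.
  rewrite big_distrr/= !big_nat; apply: eq_bigr => n /andP[_ nN].
  rewrite rint_sum// (bigD1_seq n) ?mem_index_iota ?iota_uniq//= big1 ?addr0.
    rewrite rintD// ?rintZ//; try exact: intgZ.
    have [-> ->] := rint_trig n n; rewrite eqxx mul1r; ring.
  move=> m mn; rewrite rintD// ?rintZ//; try exact: intgZ.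
  by have [-> ->] := rint_trig n m; rewrite eq_sym (negPf mn) mul0r !mulr0 addr0.
apply/funext => t; rewrite !expr2 /tsumRe /tsumIm !big_distrl -big_split/=.
apply: eq_bigr => n _; rewrite !big_distrr -big_split/=.
by apply: eq_bigr => m _; rewrite /K cosB sinB; ring.
Qed.

(** Optimising over [r]: for positive [x] and [y] the choice [r = y / x] makes the right side equal
    to [2xy]. The degenerate cases need a separate [r]. *)
Lemma amgm_le (x y z : R) : 0 <= x -> 0 <= y ->
  (forall r, 0 < r -> 2 * z <= r * x ^+ 2 + r^-1 * y ^+ 2) -> z <= x * y.
Proof.
move=> x0 y0 h; rewrite leNgt; apply/negP => zxy.
have z0 : 0 < z by rewrite (le_lt_trans _ zxy)// mulr_ge0.
have [xe|xn] := eqVneq x 0.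
  have d : 0 < y ^+ 2 + 1 by rewrite ltr_wpDl ?sqr_ge0.
  (* For [x = 0] this [r] turns the right side into [z y^2 / (y^2 + 1)], which is below [2z]. *)
  have := h ((y ^+ 2 + 1) / z) (divr_gt0 d z0).
  rewrite xe expr0n mulr0 add0r invf_div.
  have := divfK (lt0r_neq0 d) z; have := divr_gt0 z0 d; lra.
have [ye|yn] := eqVneq y 0.
  have d : 0 < x ^+ 2 + 1 by rewrite ltr_wpDl ?sqr_ge0.
  have := h (z / (x ^+ 2 + 1)) (divr_gt0 z0 d).
  rewrite ye expr0n mulr0 addr0.
  have := divfK (lt0r_neq0 d) z; have := divr_gt0 z0 d; lra.
have xp : 0 < x by rewrite lt_def xn.
have yp : 0 < y by rewrite lt_def yn.
have := h (y / x) (divr_gt0 yp xp).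
rewrite (_ : _ + _ = 2 * (x * y)); last by field; rewrite xn yn.
lra.
Qed.

(** Cauchy-Schwarz in weighted form: the pointwise bound is integrated for each [r], Parseval
    evaluates both integrals, and [amgm_le] then optimises [r]. *)
Lemma rint_tsum_le N a b a' b' (A A' : R) (F : R -> R) : 0 <= A -> 0 <= A' ->
  \sum_(0 <= n < N.+1) (a n ^+ 2 + b n ^+ 2) <= A ^+ 2 ->
  \sum_(0 <= n < N.+1) (a' n ^+ 2 + b' n ^+ 2) <= A' ^+ 2 ->
  continuous F ->
  (forall r t, 0 < r -> 0 <= t <= 2 * pi -> 2 * `|F t| <=
     r * (tsumRe N a b t ^+ 2 + tsumIm N a b t ^+ 2) +
     r^-1 * (tsumRe N a' b' t ^+ 2 + tsumIm N a' b' t ^+ 2)) ->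
  `|rint `[0, 2 * pi] F| <= 2 * pi * A * A'.
Proof.
move=> A0 A'0 hA hA' cF hF.
have pi0 := pi_gt0 R.
have p2 : 0 < 2 * pi :> R by rewrite mulr_gt0.
have iF : intg `[0, 2 * pi] F by exact: intg_continuous.
have iT c d : intg `[0, 2 * pi] (fun t => tsumRe N c d t ^+ 2 + tsumIm N c d t ^+ 2).
  apply: intg_continuous => t; apply: cvgD; rewrite !expr2; apply: cvgM;
    try exact: continuous_tsumRe; exact: continuous_tsumIm.
apply: (le_trans (le_normr_Rintegral _ iF)) => //.
rewrite -[Rintegral _ _ _]/(rint _ _) -mulrA -ler_pdivrMl//.
apply: amgm_le => // r r0.
rewrite mulrCA ler_pdivrMl//.
apply: (@le_trans _ _ (r * (2 * pi * \sum_(0 <= n < N.+1) (a n ^+ 2 + b n ^+ 2)) +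
   r^-1 * (2 * pi * \sum_(0 <= n < N.+1) (a' n ^+ 2 + b' n ^+ 2)))).
  rewrite -!rint_tsum_sqr -!rintZ//; last exact: integrable_norm iF.
  rewrite -rintD//; try exact: intgZ.
  apply: le_rint => //.
  - by apply: intgZ => //; exact: integrable_norm iF.
  - by apply: intgD => //; exact: intgZ.
  - by move=> t; rewrite /= in_itv/=; exact: hF.
have r1 : 0 < r^-1 by rewrite invr_gt0.
have h1 := ler_wpM2l (ltW (mulr_gt0 p2 r0)) hA.
have h2 := ler_wpM2l (ltW (mulr_gt0 p2 r1)) hA'.
by rewrite (mulrDr (2 * pi)) !(mulrCA _ (2 * pi)) !(mulrA (2 * pi)) lerD.
Qed.

Lemma GN_le f g N : L2 f -> L2 g ->
  `|complex.Re (GN f g N)| <= 2 * pi * norm2 f * norm2 g /\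
  `|complex.Im (GN f g N)| <= 2 * pi * norm2 f * norm2 g.
Proof.
move=> Lf Lg; pose P := tsumRe N (hRe g) (hIm g); pose Q := tsumIm N (hRe g) (hIm g).
pose P' := tsumRe N (hRe f) (hIm f); pose Q' := tsumIm N (hRe f) (hIm f).
have pi0 : 0 < 2 * pi :> R by rewrite mulr_gt0// pi_gt0.
have LphiN (t : R) : L2 (phiN N t).
  have ss (w : nat -> R) M : sqint (fun x => \sum_(0 <= n < M) w n * hermf n x).
    elim: M => [|M IH].
      by under [X in sqint X]eq_fun do rewrite big_geq//; exact: sqint0.
    under [X in sqint X]eq_fun do rewrite big_nat_recr//=.
    by apply: sqintD => //; apply: sqintZ; exact: sqint_hermf.
  have h1 : sqint (fun x => complex.Re (phiN N t x)).
    by under [X in sqint X]eq_fun do rewrite phiNE/=; exact: ss.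
  have h2 : sqint (fun x => complex.Im (phiN N t x)).
    under [X in sqint X]eq_fun do rewrite phiNE/= -mulN1r.
    by apply: sqintZ; exact: ss.
  exact: L2P.
(* The integrand is [t / 2pi] times [(P + iQ) conj(P' + iQ')]. *)
have FE t : (t%:C)%C * PN_form N t f g = Complex
    (t / (2 * pi) * (P t * P' t + Q t * Q' t)) (t / (2 * pi) * (Q t * P' t - P t * Q' t)).
  rewrite /PN_form (inner_conj (LphiN t) Lf) !inner_phiN//.
  apply/eqP; rewrite eq_complex /= -/(P t) -/(Q t) -/(P' t) -/(Q' t).
  by apply/andP; split; apply/eqP; ring.
have cP : continuous P by exact: continuous_tsumRe.
have cQ : continuous Q by exact: continuous_tsumIm.
have cP' : continuous P' by exact: continuous_tsumRe.
have cQ' : continuous Q' by exact: continuous_tsumIm.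
have ct : continuous (fun t : R => t / (2 * pi)) by move=> t; apply: cvgM; [exact: cvg_id|exact: cvg_cst].
have weight (t z : R) : 0 <= t <= 2 * pi -> `|t / (2 * pi) * z| <= `|z|.
  move=> /andP[t0 t1]; have t2 : 0 <= t / (2 * pi) by rewrite divr_ge0// ltW.
  by rewrite normrM ler_piMl// ger0_norm// ler_pdivrMr// mul1r.
have amgm (r p q p' q' : R) : 0 < r ->
    2 * `|p * p' + q * q'| <= r * (p ^+ 2 + q ^+ 2) + r^-1 * (p' ^+ 2 + q' ^+ 2).
  move=> r0; have r0' : 0 < r^-1 by rewrite invr_gt0.
  have sq (u v : R) : 2 * (u * v) <= r * u ^+ 2 + r^-1 * v ^+ 2.
    have : 0 <= r * (u - r^-1 * v) ^+ 2 by rewrite mulr_ge0 ?sqr_ge0// ltW.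
    rewrite (_ : r * _ = r * u ^+ 2 + r^-1 * v ^+ 2 - 2 * (u * v)); first lra.
    by field; rewrite gt_eqF.
  have := sq p p'; have := sq q q'; have := sq (- p) p'; have := sq (- q) q'.
  by rewrite !sqrrN !mulNr; case: (ler0P (p * p' + q * q')) => _; lra.
have hD : [set t | 0 <= t <= 2 * pi] = `[0, 2 * pi]%classic :> set R by rewrite set_itvcc.
have E1 : (fun t : R => complex.Re ((t%:C)%C * PN_form N t f g)) =
    fun t => t / (2 * pi) * (P t * P' t + Q t * Q' t) by apply/funext => t; rewrite FE.
have E2 : (fun t : R => complex.Im ((t%:C)%C * PN_form N t f g)) =
    fun t => t / (2 * pi) * (Q t * P' t - P t * Q' t) by apply/funext => t; rewrite FE.
rewrite -mulrA (mulrC (norm2 f)) mulrA /GN /cint hD /= E1 E2; split.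
- apply: (rint_tsum_le (norm2_ge0 g) (norm2_ge0 f) (bessel_hermf N.+1 Lg) (bessel_hermf N.+1 Lf)).
    move=> t; apply: cvgM; first exact: ct.
    by apply: cvgD; apply: cvgM; [exact: cP|exact: cP'|exact: cQ|exact: cQ'].
  move=> r t r0 t01.
  by apply: le_trans (amgm _ _ _ _ _ r0); rewrite ler_pM2l// weight.
- apply: (rint_tsum_le (norm2_ge0 g) (norm2_ge0 f) (bessel_hermf N.+1 Lg) (bessel_hermf N.+1 Lf)).
    move=> t; apply: cvgM; first exact: ct.
    by apply: cvgB; apply: cvgM; [exact: cQ|exact: cP'|exact: cP|exact: cQ'].
  move=> r t r0 t01.
  (* Multiplying [P + iQ] by [-i] gives the pair [(Q, -P)], which reduces the imaginary part to the
     estimate for the real part. *)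
  have := amgm r (Q t) (- P t) (P' t) (Q' t) r0; rewrite sqrrN mulNr [Q t ^+ 2 + _]addrC.
  by apply: le_trans; rewrite ler_pM2l// weight.
Qed.

(* No convergence is needed: [limn] of a divergent sequence is [0]. *)
Lemma limn_norm_le (u : nat -> R) (M : R) : 0 <= M -> (forall n, `|u n| <= M) -> `|limn u| <= M.
Proof.
move=> M0 uM; have [cu|/dvgP ->] := pselect (cvgn u); last by rewrite normr0.
rewrite ler_norml; apply/andP; split.
  by apply: limr_ge => //; apply: nearW => n; have := uM n; rewrite ler_norml => /andP[].
by apply: limr_le => //; apply: nearW => n; have := uM n; rewrite ler_norml => /andP[].
Qed.

Lemma modc_le (z : C) : modc z <= `|complex.Re z| + `|complex.Im z|.
Proof.
rewrite -[leRHS]ger0_norm ?addr_ge0// -sqrtr_sqr ler_wsqrtr//.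
rewrite /sqn -(real_normK (num_real (complex.Re z))) -(real_normK (num_real (complex.Im z))).
by rewrite sqrrD addrAC lerDl mulrn_wge0// mulr_ge0.
Qed.

Lemma half_addc_conj (z w : C) : (z + conjc w) / 2 =
  Complex ((complex.Re z + complex.Re w) / 2) ((complex.Im z - complex.Im w) / 2).
Proof.
case: z w => u v [u' v']; have -> : 2 = Complex 2 0 :> C by rewrite -[RHS]/(2%:C)%C rmorphMn.
by apply/eqP; rewrite eq_complex /=; apply/andP; split; apply/eqP; field.
Qed.

Lemma modc_half_addc_conj (z w : C) (M : R) :
  `|complex.Re z| <= M -> `|complex.Im z| <= M -> `|complex.Re w| <= M -> `|complex.Im w| <= M ->
  modc ((z + conjc w) / 2) <= M + M.
Proof.
rewrite half_addc_conj !ler_norml => /andP[? ?] /andP[? ?] /andP[? ?] /andP[? ?].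
by apply: (le_trans (modc_le _)); apply: lerD; rewrite ler_norml /=; apply/andP; split; lra.
Qed.

(** The constant is twice that of [GN_le], since the modulus is bounded by the sum of the absolute
    values of the real and imaginary parts. *)
Lemma tG_le f g : L2 f -> L2 g -> modc (tG f g) <= 4 * pi * norm2 f * norm2 g.
Proof.
move=> Lf Lg; set M := 2 * pi * norm2 f * norm2 g.
have M0 : 0 <= M by rewrite !mulr_ge0 ?norm2_ge0// ltW// pi_gt0.
have M' : 2 * pi * norm2 g * norm2 f = M by rewrite /M; ring.
have h1 : `|complex.Re (LG f g)| <= M.
  by apply: limn_norm_le => // n; case: (GN_le n Lf Lg).
have h2 : `|complex.Im (LG f g)| <= M.
  by apply: limn_norm_le => // n; case: (GN_le n Lf Lg).
have h3 : `|complex.Re (LG g f)| <= M.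
  by apply: limn_norm_le => // n; rewrite -M'; case: (GN_le n Lg Lf).
have h4 : `|complex.Im (LG g f)| <= M.
  by apply: limn_norm_le => // n; rewrite -M'; case: (GN_le n Lg Lf).
rewrite (_ : 4 * pi * norm2 f * norm2 g = M + M); last by rewrite /M; ring.
exact: modc_half_addc_conj h1 h2 h3 h4.
Qed.
End AharonovBohmBound.

(** * A primitive determines its integrand almost everywhere *)

Section Primitive.
Variable R : realType.
Local Notation mu := (@lebesgue_measure R).
Implicit Types (v w f F : R -> R) (a b k : R).

Lemma ae_imp (P Q : R -> Prop) : (forall x, P x -> Q x) ->
  {ae mu, forall x, P x} -> {ae mu, forall x, Q x}.
Proof. by move=> PQ [N [mN N0 PN]]; exists N; split => // x /= nQ; apply: PN => /= /PQ. Qed.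

Lemma ae_and (P Q : R -> Prop) :
  {ae mu, forall x, P x} -> {ae mu, forall x, Q x} -> {ae mu, forall x, P x /\ Q x}.
Proof.
move=> hP hQ; apply: negligibleS (negligibleU hP hQ).
by move=> x /= /not_andP.
Qed.

Definition rprim v (x : R) : R :=
  if 0 <= x then rint `[0, x] v else - rint `[x, 0] v.

Definition locint v : Prop := measurable_fun setT v /\ forall a b, intg `[a, b] v.

Lemma sqint_locint v : sqint v -> locint v.
Proof. by move=> sv; split => [|a b]; [case: sv|exact: sqint_intg_itv]. Qed.

Lemma continuous_locint v : continuous v -> locint v.
Proof.
by move=> cv; split => [|a b]; [exact: continuous_measurable_fun|exact: intg_continuous].
Qed.

Lemma locintB v w : locint v -> locint w -> locint (fun x => v x - w x).
Proof.
by move=> [mv iv] [mw iw]; split => [|a b]; [exact: measurable_funB|exact: intgB].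
Qed.

Lemma locint_locally_integrable v : locint v -> locally_integrable setT v.
Proof.
move=> [mv iv]; split => //; first exact: openT.
move=> K _ cK; have [M [_ hM]] := compact_bounded cK.
pose B := `|M| + 1.
have KB : K `<=` `[- B, B].
  move=> x Kx; rewrite /= in_itv/= -ler_norml; apply: hM => //.
  by rewrite /B (le_lt_trans (ler_norm _))// ltrDl.
have mK := compact_measurable cK.
have : intg K v by apply: integrableS (iv (- B) B).
by move=> /integrableP[_]; under eq_integral do rewrite abse_EFin.
Qed.

Lemma rintD_itv v a b c : a <= b -> b <= c -> intg `[a, c] v ->
  rint `[a, c] v = rint `[a, b] v + rint `[b, c] v.
Proof.
move=> ab bc iv; rewrite /rint.
have := @Rintegral_itvB _ v (BLeft a) (BRight c) b iv _ _.
rewrite !bnd_simp => /(_ ab bc).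
rewrite Rintegral_itv_obnd_cbnd; last first.
  apply: integrableS iv => //.
  by apply: subset_itvr; rewrite bnd_simp.
lra.
Qed.

(** Moves the base point from [0] to a left endpoint [a], the form in which the fundamental theorem
    of calculus applies. *)
Lemma rprimB_rint v a x : locint v -> a <= 0 -> a <= x ->
  rint `[a, x] v = rprim v x - rprim v a.
Proof.
move=> [_ iv] a0 ax.
have E0 : rprim v a = - rint `[a, 0] v.
  rewrite /rprim; case: ifP => // a0'.
  have -> : a = 0 by apply/le_anti; rewrite a0.
  by rewrite set_itv1 /rint Rintegral_set1 oppr0.
rewrite E0 opprK /rprim; case: (leP 0 x) => x0.
  by rewrite (@rintD_itv _ _ 0)// addrC.
by rewrite (@rintD_itv _ a x 0)// ?ltW//; lra.
Qed.

Lemma rprimB v w x : locint v -> locint w ->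
  rprim (fun y => v y - w y) x = rprim v x - rprim w x.
Proof.
move=> [_ iv] [_ iw]; rewrite /rprim; case: ifP => _; rewrite rintB//; ring.
Qed.

Lemma rprimZ v k x : locint v -> rprim (fun y => k * v y) x = k * rprim v x.
Proof.
move=> [_ iv]; rewrite /rprim; case: ifP => _; rewrite rintZ//; ring.
Qed.

Lemma rprim_derive f F x : continuous f -> (forall x, is_derive x (1 : R) F (f x)) ->
  rprim f x = F x - F 0.
Proof.
move=> cf dF; rewrite /rprim; case: (ltgtP 0 x) => [x0|x0|<-].
- by rewrite (rint_derive x0 cf dF).
- by rewrite (rint_derive x0 cf dF); ring.
- by rewrite set_itv1 /rint Rintegral_set1 subrr.
Qed.

(** An open interval has positive measure and so is not contained in a null set. *)
Lemma ae_itv_exists (P : R -> Prop) a b : {ae mu, forall x, P x} -> a < b ->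
  exists2 x, a < x < b & P x.
Proof.
move=> [N [mN N0 PN]] ab; apply: contrapT => h.
have sub : `]a, b[ `<=` N.
  move=> x; rewrite /= in_itv/= => xab; apply: PN => /= Px; apply: h.
  by exists x.
have : (mu `]a, b[%classic <= mu N)%E by apply: le_measure => //; rewrite inE.
by rewrite N0 lebesgue_measure_itv/= lte_fin ab -EFinD lee_fin leNgt subr_gt0 ab.
Qed.

(** A primitive is continuous, so being constant almost everywhere makes it constant everywhere. By
    Lebesgue differentiation its derivative, which is [0], equals [v] almost everywhere. *)
Lemma rprim_ae_const v k : locint v -> {ae mu, forall x, rprim v x = k} ->
  {ae mu, forall x, v x = 0}.
Proof.
move=> lv vk.
(* Primitives are taken from a finite left end [-n]; the countably many half-lines then cover the
   line. *)
suff h (n : nat) : {ae mu, forall x, - n%:R < x -> v x = 0}.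
  have := ae_foralln h.
  apply: ae_imp.
  move=> x /(_ (Num.bound `|x|)); apply.
  by rewrite ltrNl (le_lt_trans (ler_norm _))// normrN archi_boundP.
set a : R := - n%:R; have a0 : a <= 0 by rewrite oppr_le0.
pose V x := rint `[a, x] v; pose K := k - rprim v a.
have Vae : {ae mu, forall x, a <= x -> V x = K}.
  apply: ae_imp vk.
  by move=> x xk ax; rewrite /V rprimB_rint// xk.
have cV x : a < x -> {for x, continuous V}.
  move=> ax; have ax1 : a < x + 1 by rewrite (lt_trans ax)// ltrDl.
  have xi : x \in `]a, (x + 1)[ by rewrite in_itv/= ax ltrDl ltr01.
  have h := parameterized_integral_continuous (ltW ax1) (lv.2 a (x + 1)).
  exact: (within_continuous_continuous ax1 h xi).
have VK x : a < x -> V x = K.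
  move=> ax; apply/eqP; apply: contrapT => /negP ne.
  (* By continuity [V] would avoid [K] on a whole interval to the right of [x], contradicting the
     equality almost everywhere. *)
  have : \forall y \near x, V y != K.
    by apply: (cV x ax [set y | y != K]); apply: open_nbhs_nbhs; split => //; exact: open_neq.
  move=> [e /= e0 he].
  have [|y /andP[y1 y2] yV] := @ae_itv_exists _ x (x + e) Vae; first by rewrite ltrDl.
  have : V y != K.
    by apply: he; rewrite /ball/= ltr0_norm ?subr_lt0// opprB ltrBlDl.
  by rewrite yV ?eqxx// ltW// (lt_trans ax).
have := @FTC1 R v (BLeft a) (lv.2 a) (locint_locally_integrable lv).
apply: ae_imp.
move=> x h ax; have [_ <-] := h ax.
rewrite derive1E (near_eq_derive (g := cst K)) ?derive_cst//.
near=> y; apply: VK; near: y; exact: lt_nbhsr.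
Unshelve. all: by end_near. Qed.

(** The primitive of [v - f] is almost everywhere the constant [F 0 - k]. *)
Lemma rprim_ae_derive v k f F : locint v -> continuous f ->
  (forall x, is_derive x (1 : R) F (f x)) -> {ae mu, forall x, k + rprim v x = F x} ->
  {ae mu, forall x, v x = f x}.
Proof.
move=> lv cf dF h; have lf := continuous_locint cf.
have : {ae mu, forall x, v x - f x = 0}.
  apply: (@rprim_ae_const _ (F 0 - k)); first exact: locintB.
  apply: ae_imp h.
  by move=> x hx; rewrite rprimB// (rprim_derive x cf dF) -hx; ring.
apply: ae_imp.
by move=> x /eqP; rewrite subr_eq0 => /eqP.
Qed.

End Primitive.

(** * Gaussians as eigenvectors of [t] *)

Section TimeForm.
Variable R : realType.
Local Notation mu := (@lebesgue_measure R).
Local Notation C := R[i].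
Implicit Types (f g h s : R -> C) (z : C) (c b : R) (w : R -> R).

(** The explicit eigenvectors and their images are complex multiples of real functions; this shape
    reduces their norms and inner products to real integrals. *)
Definition cscale z w : R -> C := fun x => z * ((w x)%:C)%C.

Lemma Re_cscale z w x : complex.Re (cscale z w x) = complex.Re z * w x.
Proof. by case: z => u v; rewrite /cscale /=; ring. Qed.

Lemma Im_cscale z w x : complex.Im (cscale z w x) = complex.Im z * w x.
Proof. by case: z => u v; rewrite /cscale /=; ring. Qed.

Lemma L2_cscale z w : sqint w -> L2 (cscale z w).
Proof.
move=> sw; apply: L2P.
  by under [X in sqint X]eq_fun do rewrite Re_cscale; exact: sqintZ.
by under [X in sqint X]eq_fun do rewrite Im_cscale; exact: sqintZ.
Qed.

Lemma primE g x : prim g x =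
  Complex (rprim (fun y => complex.Re (g y)) x) (rprim (fun y => complex.Im (g y)) x).
Proof.
rewrite /prim /rprim set_itvcc set_itvcc; case: ifP => _ //.
Qed.

Definition gs c : R -> R := gauss (c / 2).
Definition gs' c (x : R) : R := - c * (x * gs c x).

Lemma is_derive_gs c x : is_derive x (1 : R) (gs c) (gs' c x).
Proof.
by apply: (is_derive_eq (is_derive_gauss (c / 2) x)); rewrite /gs' /gs; field.
Qed.

Lemma continuous_gs' c : continuous (gs' c).
Proof.
move=> x; apply: cvgM; first exact: cvg_cst.
by apply: cvgM; [exact: cvg_id|exact: continuous_gauss].
Qed.

Lemma gs0 c : gs c 0 = 1.
Proof. by rewrite /gs /gauss expr0n mulr0 oppr0 expR0. Qed.

Lemma gs_sqr c x : gs c x ^+ 2 = gauss c x.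
Proof. by rewrite expr2 -gaussD -splitr. Qed.

Lemma sqint_gs c : 0 < c -> sqint (gs c).
Proof.
move=> c0; split; first exact: measurable_gauss.
under [X in intg _ X]eq_fun do rewrite gs_sqr; exact: intg_gauss.
Qed.

Lemma sqint_xgs c : 0 < c -> sqint (fun x => x * gs c x).
Proof.
move=> c0; split.
  apply: continuous_measurable_fun => x.
  by apply: cvgM; [exact: cvg_id|exact: continuous_gauss].
rewrite (_ : (fun x => _) = fun x => ('X ^+ 2).[x] * gauss c x); last first.
  by apply/funext => x; rewrite hornerXn exprMn gs_sqr.
exact: intg_poly_gauss.
Qed.

(** Since [phi_c' = - c x phi_c], the operator [p = - i d/dx] gives [i c x phi_c], and dividing by
    [x] leaves [i c phi_c]. *)
Lemma is_t_gs c z : 0 < c -> is_t (cscale z (gs c)) (cscale (('i * (c%:C))%C * z) (gs c)).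
Proof.
move=> c0; exists (cscale (('i * (c%:C))%C * z) (fun x => x * gs c x)); split; split.
- by apply: L2_cscale; exact: sqint_gs.
- split; first by apply: L2_cscale; exact: sqint_xgs.
  (* The constant of integration is the value at [0], and [gs c 0 = 1]. *)
  exists z; apply: aeW => x; rewrite primE.
  have e1 : (fun y => complex.Re ('i%C * cscale (('i * (c%:C))%C * z) (fun x => x * gs c x) y)) =
     fun y => complex.Re z * gs' c y.
    by apply/funext => y; rewrite /cscale /gs'; case: z => u v /=; ring.
  have e2 : (fun y => complex.Im ('i%C * cscale (('i * (c%:C))%C * z) (fun x => x * gs c x) y)) =
     fun y => complex.Im z * gs' c y.
    by apply/funext => y; rewrite /cscale /gs'; case: z {e1} => u v /=; ring.
  have lg := continuous_locint (@continuous_gs' c).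
  rewrite e1 e2 (rprimZ (complex.Re z))// (rprimZ (complex.Im z))// (rprim_derive x (@continuous_gs' c) (is_derive_gs c)) gs0 /cscale.
  by case: z {e1 e2} => u v; apply/eqP; rewrite eq_complex /=; apply/andP; split; apply/eqP; ring.
- by apply: L2_cscale; exact: sqint_xgs.
- split; first by apply: L2_cscale; exact: sqint_gs.
  have : {ae mu, forall x : R, x != 0}.
    exists [set 0]; split => //; first exact: lebesgue_measure_set1.
    by move=> x /= /negP; rewrite negbK => /eqP.
  apply: ae_imp => x x0; rewrite /cscale rmorphM /=; field.
  by rewrite (inj_eq (@complexI R)).
Qed.

(** The witness [g] for [p f] is known only through its primitive. [rprim_ae_derive], applied to the
    real and imaginary parts of [i g], recovers it almost everywhere, and the division by [x] is
    made off the null set [{0}]. *)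
Lemma is_t_gs_unique c z f h : 0 < c -> is_t f h -> aeeq f (cscale z (gs c)) ->
  aeeq h (cscale (('i * (c%:C))%C * z) (gs c)).
Proof.
move=> c0 [g [[Lf [Lg [k fk]]] [_ [Lh hg]]]] fz.
pose w y := 'i%C * g y.
have lRe : locint (fun y => complex.Re (w y)).
  rewrite (_ : (fun y => _) = fun y => -1 * complex.Im (g y)).
    by apply: sqint_locint; apply: sqintZ; exact: L2_Im.
  by apply/funext => y; rewrite /w; case: (g y) => u v /=; ring.
have lIm : locint (fun y => complex.Im (w y)).
  rewrite (_ : (fun y => _) = fun y => complex.Re (g y)).
    by apply: sqint_locint; exact: L2_Re.
  by apply/funext => y; rewrite /w; case: (g y) => u v /=; ring.
have cz (r : R) : continuous (fun x => r * gs' c x).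
  by move=> x; apply: cvgM; [exact: cvg_cst|exact: continuous_gs'].
have dz (r x : R) : is_derive x (1 : R) (fun x => r * gs c x) (r * gs' c x).
  have hd := is_derive_gs c x.
  exact: (is_derive_eq (is_deriveZ r hd)).
have E1 : {ae mu, forall x, complex.Re (w x) = complex.Re z * gs' c x}.
  apply: (rprim_ae_derive (k := complex.Re k) lRe (cz _) (dz _)).
  apply: ae_imp (ae_and fk fz) => x [e1 e2].
  have := congr1 (@complex.Re R) (etrans (esym e1) e2); rewrite Re_cscale primE => <-.
  by case: (k).
have E2 : {ae mu, forall x, complex.Im (w x) = complex.Im z * gs' c x}.
  apply: (rprim_ae_derive (k := complex.Im k) lIm (cz _) (dz _)).
  apply: ae_imp (ae_and fk fz) => x [e1 e2].
  have := congr1 (@complex.Im R) (etrans (esym e1) e2); rewrite Im_cscale primE => <-.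
  by case: (k).
have E3 : {ae mu, forall x : R, x != 0}.
  exists [set 0]; split => //; first exact: lebesgue_measure_set1.
  by move=> x /= /negP; rewrite negbK => /eqP.
apply: ae_imp (ae_and (ae_and hg E3) (ae_and E1 E2)) => x [[-> x0] [e1 e2]].
have -> : g x = cscale (('i * (c%:C))%C * z) (fun x => x * gs c x) x.
  move: e1 e2; rewrite /w /cscale /gs'; case: (g x) (z) => u v [u' v'] /= e1 e2.
  by apply/eqP; rewrite eq_complex /=; apply/andP; split; apply/eqP; lra.
rewrite /cscale rmorphM /=; field.
by rewrite (inj_eq (@complexI R)).
Qed.

Lemma tpow_gs c n : 0 < c ->
  tpow (@is_t R) n (cscale 1 (gs c)) (cscale (('i * (c%:C))%C ^+ n) (gs c)).
Proof.
move=> c0; elim: n => [|n IH] /=.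
  by split; [apply: L2_cscale; exact: sqint_gs|apply: aeW => x; rewrite expr0].
exists (cscale (('i * (c%:C))%C ^+ n) (gs c)); split => //.
by rewrite exprS; exact: is_t_gs.
Qed.

Lemma tpow_gs_unique c n f : 0 < c -> tpow (@is_t R) n (cscale 1 (gs c)) f ->
  aeeq f (cscale (('i * (c%:C))%C ^+ n) (gs c)).
Proof.
move=> c0; elim: n f => [|n IH] f /=.
  by move=> [_]; apply: ae_imp => x <-; rewrite expr0.
by move=> [g [/IH hg tf]]; rewrite exprS; exact: is_t_gs_unique tf hg.
Qed.

(* partial sums of the series of [artanh c] *)
Definition kappaN c (N : nat) : R := \sum_(0 <= n < N.+1) c ^+ n.*2.+1 / n.*2.+1%:R.
Definition kappa c : R := limn (kappaN c).

Lemma kappaN_nondecreasing c : 0 <= c -> {homo kappaN c : n m / (n <= m)%N >-> n <= m}.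
Proof.
move=> c0; apply/nondecreasing_seqP => n; rewrite /kappaN [leRHS]big_nat_recr//= lerDl.
by rewrite divr_ge0// exprn_ge0.
Qed.

Lemma kappaN_cvg c : 0 <= c < 1 -> cvgn (kappaN c).
Proof.
move=> /andP[c0 c1]; apply: nondecreasing_is_cvgn; first exact: kappaN_nondecreasing.
exists (1 - c)^-1 => _ [N _ <-].
have d : 0 < 1 - c by rewrite subr_gt0.
(* Each term is at most [c^n], so a geometric sum bounds the partial sums. *)
have h (M : nat) : \sum_(0 <= n < M) c ^+ n.*2.+1 / n.*2.+1%:R <= (1 - c ^+ M) / (1 - c).
  elim: M => [|M IH]; first by rewrite big_geq// expr0 subrr mul0r.
  rewrite big_nat_recr//=.
  have -> : (1 - c ^+ M.+1) / (1 - c) = (1 - c ^+ M) / (1 - c) + c ^+ M.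
    by rewrite exprS; field; rewrite gt_eqF.
  apply: lerD => //; rewrite ler_pdivrMr ?ltr0n//.
  apply: (@le_trans _ _ (c ^+ M)).
    apply: ler_wiXn2l => //; first exact: ltW.
    by rewrite -addnn -addnS leq_addr.
  by rewrite ler_peMr ?exprn_ge0// ler1n.
apply: (le_trans (h N.+1)); rewrite ler_pdivrMr// mulVf ?gt_eqF//.
by rewrite gerBl exprn_ge0.
Qed.

(** The sign [(-1)^n] cancels against [i^(2n+1) = (-1)^n i], so all terms add up with the same
    phase. *)
Lemma sum_tpow_gs c N x :
  \sum_(0 <= n < N.+1) ((-1) ^+ n / (n.*2.+1)%:R : C) *
     cscale (('i * (c%:C))%C ^+ n.*2.+1) (gs c) x =
  cscale ('i%C * ((kappaN c N)%:C)%C) (gs c) x.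
Proof.
rewrite /kappaN; elim: N.+1 => [|M IH].
  by rewrite !big_geq// /cscale mulr0 mul0r.
rewrite !big_nat_recr//= {}IH /cscale.
have -> : (('i * c%:C) ^+ M.*2.+1)%C = ((-1) ^+ M * 'i * (c ^+ M.*2.+1)%:C)%C :> C.
  by rewrite exprMn [in 'i%C ^+ _]exprS -mul2n exprM sqr_i rmorphXn /=; congr (_ * _); exact: mulrC.
have h : ((-1) ^+ M * (-1) ^+ M = 1 :> C).
  by rewrite -exprMn mulrNN mulr1 expr1n.
rewrite rmorphD /= fmorph_div /= rmorph_nat.
rewrite (_ : _ * (_ * _) = ((-1) ^+ M * (-1) ^+ M) * ('i * (c ^+ M.*2.+1)%:C / (M.*2.+1)%:R * (gs c x)%:C)%C); last by ring.
by rewrite h mul1r mulrDr mulrDl !mulrA.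
Qed.

Lemma norm2_aeeq f g : L2 f -> cmeas g -> aeeq f g -> norm2 f = norm2 g.
Proof.
move=> [[m1 m2] _] [m3 m4] fg; congr Num.sqrt; congr fine.
apply: ae_eq_integral => //.
- by apply/measurable_EFinP; apply: measurable_funD; exact: measurable_funX.
- by apply/measurable_EFinP; apply: measurable_funD; exact: measurable_funX.
- by apply: ae_imp fg => x + _; move=> ->.
Qed.

Lemma norm2_cscale z w : sqint w ->
  norm2 (cscale z w) ^+ 2 = sqn z * rint setT (fun x => w x ^+ 2).
Proof.
move=> sw; rewrite norm2_sqr -rintZ//; last by case: sw.
congr rint; apply/funext => x.
by rewrite /sqn Re_cscale Im_cscale; ring.
Qed.

Lemma kappaN_kappa c : 0 <= c < 1 -> kappaN c N @[N --> \oo] --> kappa c.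
Proof. by move=> /kappaN_cvg. Qed.

(** * The operator [S] on Gaussians *)

Definition Sgs c : R -> C := cscale (- ('i * (kappa c)%:C)%C) (gs c).

(** The remainder after [N] is exactly [i (kappaN c N - kappa c) phi_c], so its norm is
    [|kappaN c N - kappa c|] times a constant. *)
Lemma isS_gs c : 0 < c < 1 -> isS (@is_t R) (@is_even R) (cscale 1 (gs c)) (Sgs c).
Proof.
move=> /andP[c0 c1]; have sg := sqint_gs c0; split.
  by apply: aeW => x; rewrite /cscale /gs /gauss sqrrN.
split; first exact: L2_cscale.
exists (fun n => cscale (('i * (c%:C))%C ^+ n.*2.+1) (gs c)); split.
  by move=> n; exact: tpow_gs.
set u := (X in X @ _ --> _).
have uE N : u N = Num.sqrt ((kappaN c N - kappa c) ^+ 2 * rint setT (fun x => gs c x ^+ 2)).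
  rewrite -[u N]ger0_norm ?norm2_ge0// -sqrtr_sqr; congr Num.sqrt.
  rewrite (_ : u N = norm2 (cscale ('i%C * ((kappaN c N - kappa c)%:C)%C) (gs c))).
    by rewrite norm2_cscale//; congr (_ * _); rewrite /sqn /=; ring.
  congr norm2; apply/funext => x; rewrite sum_tpow_gs /Sgs /cscale rmorphB /=.
  by rewrite mulrBr mulrBl mulNr addrC.
have kc : kappaN c N @[N --> \oo] --> kappa c by apply: kappaN_kappa; rewrite ltW.
have kc0 : kappaN c N - kappa c @[N --> \oo] --> 0.
  by rewrite -(subrr (kappa c)); apply: cvgB => //; exact: cvg_cst.
rewrite (_ : u = fun N => `|kappaN c N - kappa c| * Num.sqrt (rint setT (fun x => gs c x ^+ 2))).
  rewrite -(mul0r (Num.sqrt (rint setT (fun x => gs c x ^+ 2)))).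
  apply: cvgM; last exact: cvg_cst.
  by rewrite -[X in _ --> X](normr0 R); apply: cvg_norm.
by apply/funext => N; rewrite uE sqrtrM ?sqr_ge0// sqrtr_sqr.
Qed.

Lemma L2Z z f : L2 f -> L2 (fun x => z * f x).
Proof.
move=> Lf; have [sr si] := (L2_Re Lf, L2_Im Lf); apply: L2P.
  rewrite (_ : (fun x => _) = fun x => complex.Re z * complex.Re (f x) - complex.Im z * complex.Im (f x)).
    by apply: sqintB; exact: sqintZ.
  by apply/funext => x; case: z (f x) => u v [].
rewrite (_ : (fun x => _) = fun x => complex.Re z * complex.Im (f x) + complex.Im z * complex.Re (f x)).
  by apply: sqintD; exact: sqintZ.
by apply/funext => x; case: z (f x) => u v [].
Qed.

Lemma L2_0 : L2 (fun=> 0 : C).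
Proof. by apply: L2P => /=; exact: sqint0. Qed.

Lemma tpow_L2 n f h : tpow (@is_t R) n.+1 f h -> L2 h.
Proof. by move=> [g [_ [k [_ [_ []]]]]]. Qed.

Lemma sqnD_le (z1 z2 : C) : sqn (z1 + z2) <= 2 * sqn z1 + 2 * sqn z2.
Proof.
case: z1 z2 => u v [u' v']; rewrite /sqn /=.
have := sqr_ge0 (u - u'); have := sqr_ge0 (v - v'); lra.
Qed.

Lemma L2D f g : L2 f -> L2 g -> L2 (fun x => f x + g x).
Proof.
move=> Lf Lg; apply: L2P.
  rewrite (_ : (fun x => _) = fun x => complex.Re (f x) + complex.Re (g x)).
    by apply: sqintD; exact: L2_Re.
  by apply/funext => x; case: (f x) (g x) => u v [].
rewrite (_ : (fun x => _) = fun x => complex.Im (f x) + complex.Im (g x)).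
  by apply: sqintD; exact: L2_Im.
by apply/funext => x; case: (f x) (g x) => u v [].
Qed.

Lemma L2_sum (F : nat -> R -> C) N : (forall n, L2 (F n)) ->
  L2 (fun x => \sum_(0 <= n < N) F n x).
Proof.
move=> LF; elim: N => [|N IH].
  by under [X in L2 X]eq_fun do rewrite big_geq//; exact: L2_0.
by under [X in L2 X]eq_fun do rewrite big_nat_recr//=; exact: L2D.
Qed.

(** Integrates [|z1 + z2|^2 <= 2 |z1|^2 + 2 |z2|^2], which serves in place of the triangle
    inequality. *)
Lemma norm2D_le f g : L2 f -> L2 g ->
  norm2 (fun x => f x + g x) ^+ 2 <= 2 * norm2 f ^+ 2 + 2 * norm2 g ^+ 2.
Proof.
move=> Lf Lg; rewrite !norm2_sqr -!rintZ//; [|by case: Lg|by case: Lf].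
have if_ : intg setT (fun x => sqn (f x)) by case: Lf.
have ig_ : intg setT (fun x => sqn (g x)) by case: Lg.
rewrite -rintD//; [|exact: intgZ|exact: intgZ].
apply: le_rint => //.
- by case: (L2D Lf Lg).
- by apply: intgD => //; exact: intgZ.
- by move=> x _; exact: sqnD_le.
Qed.

Lemma norm2_eq0 f : L2 f -> norm2 f = 0 -> aeeq f (fun=> 0).
Proof.
move=> Lf nf; have i : intg setT (fun x => sqn (f x)) by case: Lf.
have mf : measurable_fun setT (EFin \o (fun x => sqn (f x))) by exact: (measurable_int mu i).
have e : (\int[mu]_x `|(EFin \o (fun x => sqn (f x))) x|)%E = 0%E.
  under eq_integral do rewrite /= ger0_norm ?sqn_ge0//.
  have := norm2_sqr f; rewrite nf expr0n /= /rint /Rintegral => /esym h.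
  by rewrite -[LHS]fineK ?h//; exact: (integrable_fin_num measurableT i).
have := (ae_eq_integral_abs mu measurableT mf).1 e.
apply: ae_imp => x /(_ Logic.I) /= [/eqP].
rewrite /sqn paddr_eq0 ?sqr_ge0// !sqrf_eq0 => /andP[/eqP e1 /eqP e2].
by apply/eqP; rewrite eq_complex e1 e2 !eqxx.
Qed.

(** Put [d = s + i kappa(c) phi_c]. For each [N] it is the sum of the given remainder [r N] and a
    multiple of [phi_c] with coefficient [i (kappa c - kappaN c N)]; both tend to [0] in norm, hence
    [d = 0] almost everywhere. *)
Lemma isS_gs_unique c s : 0 < c < 1 ->
  isS (@is_t R) (@is_even R) (cscale 1 (gs c)) s -> aeeq s (Sgs c).
Proof.
move=> c01; have /andP[c0 c1] := c01; have sg := sqint_gs c0.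
move=> [_ [Ls [a [ta cva]]]].
(* Countably many exceptional sets are merged into one null set valid for all powers. *)
have aE : {ae mu, forall x n, a n x = cscale (('i * (c%:C))%C ^+ n.*2.+1) (gs c) x}.
  by apply: ae_foralln => n; exact: tpow_gs_unique (ta n).
pose r N := fun x => s x + cscale ('i%C * ((kappaN c N)%:C)%C) (gs c) x.
pose d : R -> C := fun x => s x + cscale ('i%C * ((kappa c)%:C)%C) (gs c) x.
have Lr N : L2 (r N) by apply: L2D => //; exact: L2_cscale.
have Ld : L2 d by apply: L2D => //; exact: L2_cscale.
have cr : norm2 (r N) @[N --> \oo] --> (0 : R).
  apply: cvg_trans cva; apply: near_eq_cvg; apply: nearW => N; apply: esym; apply: norm2_aeeq => //.
    have La n : L2 (fun x => ((-1) ^+ n / (n.*2.+1)%:R : C) * a n x) := L2Z _ (tpow_L2 (ta n)).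
    exact: (L2D Ls (L2_sum N.+1 La)).1.
  apply: ae_imp aE => x ax; rewrite /r -sum_tpow_gs; congr (_ + _).
  by apply: eq_bigr => n _; rewrite ax.
have kc : kappa c - kappaN c N @[N --> \oo] --> 0.
  rewrite -(subrr (kappa c)); apply: cvgB; first exact: cvg_cst.
  by apply: kappaN_kappa; rewrite ltW.
pose G := rint setT (fun x => gs c x ^+ 2).
have bound N : norm2 d ^+ 2 <= 2 * norm2 (r N) ^+ 2 + 2 * ((kappa c - kappaN c N) ^+ 2 * G).
  pose e := cscale ('i%C * ((kappa c - kappaN c N)%:C)%C) (gs c).
  have -> : (kappa c - kappaN c N) ^+ 2 * G = norm2 e ^+ 2.
    by rewrite norm2_cscale//; congr (_ * _); rewrite /sqn /=; ring.
  have -> : d = fun x => r N x + e x.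
    apply/funext => x; rewrite /d /r /e /cscale -addrA -mulrDl -mulrDr -rmorphD /=.
    by rewrite (_ : kappaN c N + (kappa c - kappaN c N) = kappa c)//; ring.
  by apply: norm2D_le => //; exact: L2_cscale.
have d0 : norm2 d ^+ 2 <= 0.
  have cb : 2 * norm2 (r N) ^+ 2 + 2 * ((kappa c - kappaN c N) ^+ 2 * G) @[N --> \oo] -->
      2 * 0 ^+ 2 + 2 * (0 ^+ 2 * G).
    apply: cvgD; apply: cvgM; try exact: cvg_cst.
      by rewrite expr2; apply: cvgM.
    by apply: cvgM; last exact: cvg_cst; rewrite expr2; apply: cvgM.
  have -> : 0 = 2 * 0 ^+ 2 + 2 * (0 ^+ 2 * G) by ring.
  rewrite -(cvg_lim _ cb)//; apply: limr_ge; first by apply/cvg_ex; exists (2 * 0 ^+ 2 + 2 * (0 ^+ 2 * G)).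
  exact: nearW.
have /(norm2_eq0 Ld) : norm2 d = 0.
  by apply/eqP; rewrite -sqrf_eq0 eq_le d0 sqr_ge0.
apply: ae_imp => x /eqP; rewrite /d addr_eq0 => /eqP ->.
by rewrite /Sgs /cscale mulNr.
Qed.

(** [S] picks a value by [epsilon]: [isS_gs] shows that a value exists, and [isS_gs_unique]
    identifies the chosen one up to a null set. *)
Lemma S_gs c : 0 < c < 1 -> aeeq (S (cscale 1 (gs c))) (Sgs c) /\ L2 (S (cscale 1 (gs c))).
Proof.
move=> c01.
have h : isS (@is_t R) (@is_even R) (cscale 1 (gs c)) (S (cscale 1 (gs c))).
  by apply: ClassicalEpsilon.epsilon_spec; exists (Sgs c); exact: isS_gs.
by split; [exact: isS_gs_unique|case: h => _ []].
Qed.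

Lemma rint_aeeq v w : measurable_fun setT v -> measurable_fun setT w ->
  {ae mu, forall x, v x = w x} -> rint setT v = rint setT w.
Proof.
move=> mv mw vw; congr fine; apply: ae_eq_integral => //; try exact/measurable_EFinP.
by apply: ae_imp vw => x + _; move=> ->.
Qed.

Lemma inner_aeeq f g h : L2 f -> L2 g -> L2 h -> aeeq g h -> inner f g = inner f h.
Proof.
move=> Lf [[g1 g2] _] [[h1 h2] _] gh; have [[f1 f2] _] := Lf.
rewrite !innerE; congr Complex; apply: rint_aeeq.
- by apply: measurable_funD; exact: measurable_funM.
- by apply: measurable_funD; exact: measurable_funM.
- by apply: ae_imp gh => x ->.
- by apply: measurable_funB; exact: measurable_funM.
- by apply: measurable_funB; exact: measurable_funM.
- by apply: ae_imp gh => x ->.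
Qed.

(** * The form [tform] on Gaussians *)

Lemma inner_gs_S b c : 0 < b -> 0 < c < 1 -> inner (cscale 1 (gs b)) (S (cscale 1 (gs c))) =
  Complex 0 (- kappa c * rint setT (fun x => gs b x * gs c x)).
Proof.
move=> b0 c01; have /andP[c0 c1] := c01; have [sb sc] := (sqint_gs b0, sqint_gs c0).
have [ae LS] := S_gs c01.
rewrite (@inner_aeeq _ _ (Sgs c))//; [|exact: L2_cscale|exact: L2_cscale].
rewrite innerE; congr Complex.
  rewrite -[RHS](@rint0 R setT); congr rint; apply/funext => x.
  by rewrite !Re_cscale !Im_cscale /=; ring.
rewrite -rintZ//; last exact: sqint_mul.
by congr rint; apply/funext => x; rewrite !Re_cscale !Im_cscale /=; ring.
Qed.

Lemma evp_gs c : evp (cscale 1 (gs c)) = cscale 1 (gs c).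
Proof.
apply/funext => x; rewrite /evp /cscale /gs /gauss sqrrN -mulr2n -[_ *+ 2]mulr_natr mulfK//.
Qed.

Lemma odp_gs c : odp (cscale 1 (gs c)) = fun=> 0.
Proof. by apply/funext => x; rewrite /odp /cscale /gs /gauss sqrrN subrr mul0r. Qed.

Lemma inner0 f : inner (fun=> 0) f = 0.
Proof.
rewrite innerE; apply/eqP; rewrite eq_complex /=.
by apply/andP; split; rewrite -[X in _ == X](@rint0 R setT); apply/eqP; congr rint;
  apply/funext => x; ring.
Qed.

Lemma inner0r f : inner f (fun=> 0) = 0.
Proof.
rewrite innerE; apply/eqP; rewrite eq_complex /=.
by apply/andP; split; rewrite -[X in _ == X](@rint0 R setT); apply/eqP; congr rint;
  apply/funext => x; ring.
Qed.

Lemma norm2_0 : norm2 (fun=> 0 : C) = 0.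
Proof.
apply/eqP; rewrite -sqrf_eq0 norm2_sqr -[X in _ == X](@rint0 R setT); apply/eqP.
by congr rint; apply/funext => x; rewrite /sqn /=; ring.
Qed.

(** The odd part of a Gaussian is [0], so this settles the second half of its membership in the form
    domain. *)
Lemma isS_0 : isS (@is_tadj R) (@is_odd R) (fun=> 0) (fun=> 0).
Proof.
have h n : tpow (@is_tadj R) n (fun=> 0) (fun=> 0).
  elim: n => [|n IH] /=; first by split; [exact: L2_0|exact: aeW].
  exists (fun=> 0); split => //; split; first exact: L2_0.
  by split; [exact: L2_0|move=> f g _; rewrite !inner0].
split; first by apply: aeW => x; rewrite oppr0.
split; first exact: L2_0.
exists (fun n => fun=> 0); split => //.
rewrite (_ : (fun N => _) = fun=> 0); first exact: cvg_cst.
apply/funext => N; rewrite -[RHS]norm2_0; congr norm2; apply/funext => x.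
by rewrite big1 ?addr0// => n _; rewrite mulr0.
Qed.

Lemma inD_gs c : 0 < c < 1 -> inD (cscale 1 (gs c)).
Proof.
move=> c01; rewrite /inD evp_gs odp_gs; split; first by exists (Sgs c); exact: isS_gs.
by exists (fun=> 0); exact: isS_0.
Qed.

Lemma tform_gs b c : 0 < b < 1 -> 0 < c < 1 -> modc (tform (cscale 1 (gs b)) (cscale 1 (gs c))) =
  `|kappa c - kappa b| * rint setT (fun x => gs b x * gs c x) / 2.
Proof.
move=> b01 c01; have [/andP[b0 b1] /andP[c0 c1]] := (b01, c01).
(* The odd parts are [0], so the second summand vanishes whatever value [epsilon] selects for
   [Sstar]. *)
rewrite /tform !evp_gs !odp_gs inner0 inner0r.
have [_ LS] := S_gs b01.
rewrite (@inner_conj R (cscale 1 (gs c)) (S (cscale 1 (gs b))))//; last first.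
  by apply: L2_cscale; exact: sqint_gs.
rewrite !inner_gs_S//.
rewrite (_ : rint setT (fun x => gs c x * gs b x) = rint setT (fun x => gs b x * gs c x)); last first.
  by congr rint; apply/funext => x; rewrite mulrC.
set I := rint _ _; have I0 : 0 <= I.
  by apply: rint_ge0 => x; rewrite mulr_ge0// gauss_ge0.
rewrite addr0 mul0r addr0 half_addc_conj /modc /sqn /=.
rewrite (_ : _ + _ = ((kappa c - kappa b) * I / 2) ^+ 2); last by field.
by rewrite sqrtr_sqr !normrM (ger0_norm I0) normfV (ger0_norm (ler0n R 2)).
Qed.

(** * Unboundedness of [tform] *)

(** Bernoulli's inequality. *)
Lemma onem_le_expn (x : R) n : 0 <= x <= 1 -> 1 - n%:R * x <= (1 - x) ^+ n.
Proof.
move=> /andP[x0 x1]; elim: n => [|n IH]; first by rewrite expr0 mul0r subr0.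
have d : 0 <= 1 - x by rewrite subr_ge0.
rewrite exprS; apply: le_trans (ler_wpM2l d IH).
rewrite -[n.+1]addn1 natrD.
have : 0 <= n%:R * x ^+ 2 by rewrite mulr_ge0 ?sqr_ge0.
lra.
Qed.

(** A bound [B] on [kappa] near [1] would bound the harmonic partial sums by [4 B], against their
    divergence. *)
Lemma kappa_unbounded (B : R) : exists2 c, 2^-1 <= c < 1 & B < kappa c.
Proof.
apply: contrapT => hB.
have kB c : 2^-1 <= c < 1 -> kappa c <= B.
  by move=> hc; rewrite leNgt; apply/negP => lt; apply: hB; exists c.
apply: (@dvg_harmonic R); apply: nondecreasing_is_cvgn.
  apply/nondecreasing_seqP => n; rewrite /series/= [leRHS]big_nat_recr//= lerDl.
  by rewrite invr_ge0.
(* One factor [2] comes from [c^(2k+1) >= 1/2], the other from [2k+1 <= 2(k+1)]. *)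
exists (4 * B) => _ [N _ <-].
pose m : R := N.*2.+1%:R; have m0 : 0 < m by rewrite ltr0n.
have m1 : 1 <= m by rewrite ler1n.
(* For [c = 1 - e] Bernoulli gives [c^m >= 1 - m e = 1/2], and smaller powers of [c] are at least as
   large. *)
have [e [e0 e1 me]] : exists e : R, [/\ 0 < e, e <= 2^-1 & m * e = 2^-1].
  exists (2^-1 / m); split; first by rewrite divr_gt0.
  - by rewrite ler_pdivrMr// ler_peMr.
  - by rewrite mulrC divfK// gt_eqF.
pose c : R := 1 - e.
have c01 : 2^-1 <= c < 1 by rewrite /c; apply/andP; split; lra.
have c0 : 0 <= c by case/andP: c01 => + _; apply: le_trans; rewrite invr_ge0.
have c1 : c <= 1 by case/andP: c01 => _ /ltW.
have cm : 2^-1 <= c ^+ N.*2.+1.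
  apply: le_trans (onem_le_expn _ _); last by apply/andP; split; lra.
  by rewrite -/m me; lra.
have : kappaN c N <= B.
  apply: le_trans (kB _ c01); apply: nondecreasing_cvgn_le.
    exact: kappaN_nondecreasing.
  by apply: kappaN_cvg; case/andP: c01 => _ ->; rewrite c0.
move=> kN; apply: (@le_trans _ _ (4 * kappaN c N)); last by rewrite ler_pM2l.
(* [kappaN c N] has one term more than the harmonic sum; it is nonnegative and is dropped. *)
rewrite /series/= /kappaN big_nat_recr//= mulrDr; apply: ler_wpDr.
  by rewrite mulr_ge0// divr_ge0// exprn_ge0.
rewrite big_distrr/= !big_nat; apply: ler_sum => k /andP[_ kN'].
have ck : 2^-1 <= c ^+ k.*2.+1.
  by apply: (le_trans cm); apply: ler_wiXn2l => //; rewrite ltnS leq_double ltnW.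
rewrite mulrA ler_pdivlMr ?ltr0n// mulrC ler_pdivrMr ?ltr0n//.
have : k.*2.+1%:R <= 2 * k.+1%:R :> R by rewrite -natrM ler_nat mul2n doubleS ltnW.
have : 0 < k.+1%:R :> R by rewrite ltr0n.
nra.
Qed.

Lemma tform_unbounded : ~ (exists M : R, forall f g, inD f -> inD g ->
  modc (tform f g) <= M * norm2 f * norm2 g).
Proof.
move=> [M hM]; pose b : R := 2^-1.
have b01 : 0 < b < 1 by rewrite /b; apply/andP; split; lra.
(* [K] bounds [|phi_c|^2] from above for [c >= 1/2], and [I0] bounds [(phi_b, phi_c)] from below for
   [c < 1], because [gauss] decreases in its parameter. *)
pose K := rint setT (gauss (2^-1 : R)); pose I0 := rint setT (gauss (1 : R)).
have I0p : 0 < I0.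
  have := gint1 R; rewrite /gint.
  under [X in rint _ X]eq_fun do rewrite hornerC mul1r.
  by rewrite -/I0 => ->; rewrite sqrtr_gt0 pi_gt0.
have K0 : 0 <= K by apply: rint_ge0 => x; exact: gauss_ge0.
have gauss_le (c d : R) x : c <= d -> gauss d x <= gauss c x.
  by move=> cd; rewrite /gauss ler_expR lerN2 ler_wpM2r ?sqr_ge0.
have nK c : b <= c -> norm2 (cscale 1 (gs c)) <= Num.sqrt K.
  move=> bc; have c0 : 0 < c by case/andP: b01 => /lt_le_trans + _; apply.
  rewrite -[leLHS]ger0_norm ?norm2_ge0// -sqrtr_sqr ler_wsqrtr//.
  rewrite norm2_cscale; last exact: sqint_gs.
  rewrite /sqn /= expr0n expr1n addr0 mul1r.
  under [X in rint _ X]eq_fun do rewrite gs_sqr.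
  by apply: le_rint => // [||x _]; [exact: intg_gauss|apply: intg_gauss; rewrite invr_gt0|exact: gauss_le].
(* The threshold forces [(kappa c - kappa b) I0 / 2 > |M| K]; the absolute value covers a negative
   [M]. *)
have [c /andP[bc c1] hc] := kappa_unbounded (kappa b + 2 * (`|M| * K) / I0).
have c0 : 0 < c by case/andP: b01 => /lt_le_trans + _; apply.
have c01 : 0 < c < 1 by rewrite c0.
have := hM _ _ (inD_gs b01) (inD_gs c01); apply/negP; rewrite -ltNge tform_gs//.
have up : M * norm2 (cscale 1 (gs b)) * norm2 (cscale 1 (gs c)) <= `|M| * K.
  apply: (@le_trans _ _ (`|M| * norm2 (cscale 1 (gs b)) * norm2 (cscale 1 (gs c)))).
    by rewrite ler_wpM2r ?norm2_ge0// ler_wpM2r ?norm2_ge0// ler_norm.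
  rewrite -mulrA ler_wpM2l// -[K in leRHS]sqr_sqrtr// expr2.
  by apply: ler_pM; rewrite ?norm2_ge0// nK.
apply: (le_lt_trans up); rewrite ltr_pdivlMr//.
have lowI : I0 <= rint setT (fun x => gs b x * gs c x).
  have hbc : 0 < b / 2 + c / 2 by rewrite addr_gt0 ?divr_gt0//; case/andP: b01.
  have hbc1 : b / 2 + c / 2 <= 1.
    by rewrite -mulrDl ler_pdivrMr// mul1r lerD ?ltW//; case/andP: b01.
  under [X in _ <= rint _ X]eq_fun do rewrite /gs -gaussD.
  by apply: le_rint => // [||x _]; [exact: intg_gauss|exact: intg_gauss|exact: gauss_le].
have kp : 2 * (`|M| * K) / I0 < kappa c - kappa b by rewrite ltrBrDl.
have kp0 : 0 <= 2 * (`|M| * K) / I0.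
  exact: divr_ge0 (mulr_ge0 (ler0n R 2) (mulr_ge0 (normr_ge0 M) K0)) (ltW I0p).
have kd := le_lt_trans kp0 kp; rewrite (gtr0_norm kd).
apply: (@lt_le_trans _ _ ((kappa c - kappa b) * I0)).
  by rewrite mulrC -ltr_pdivrMr.
exact: ler_wpM2l (ltW kd) _ _ lowI.
Qed.

(** The entry of index [0] in each series is a first power of the operator, whose domain lies in
    [L2]; this applies to the even and the odd part, and [f] is their sum. *)
Lemma inD_L2 f : inD f -> L2 f.
Proof.
move=> [[s [_ [_ [a [ta _]]]]] [s' [_ [_ [a' [ta' _]]]]]].
have L1 : L2 (evp f) by have [g [[Lg _] [k [[]]]]] := ta 0%N.
have L3 : L2 (odp f) by have [g [[Lg _] []]] := ta' 0%N.
rewrite (_ : f = fun x => evp f x + odp f x); first exact: L2D.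
apply/funext => x; rewrite /evp /odp -mulrDl addrACA subrr addr0 -mulr2n -[_ *+ 2]mulr_natr.
by rewrite mulfK.
Qed.

End TimeForm.

(** * Comparison of the two forms *)

Theorem theorem6p6 (R : realType) :
  (exists psi phi : R -> R[i],
      inD psi /\ inD phi /\ tform psi phi <> tG psi phi)
  /\ (exists M : R, forall f g : R -> R[i],
        L2 f -> L2 g -> modc (tG f g) <= M * norm2 f * norm2 g)
  /\ ~ (exists M : R, forall f g : R -> R[i],
        inD f -> inD g -> modc (tform f g) <= M * norm2 f * norm2 g).
Proof.
split; last by split; [exists (4 * pi) => f g; exact: tG_le|exact: tform_unbounded].
(* If no pair separated the forms, the bound for [tG] would carry over to [tform]. *)
apply: contrapT => h; apply: (@tform_unbounded R); exists (4 * pi) => f g Df Dg.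
rewrite (_ : tform f g = tG f g); first by apply: tG_le; exact: inD_L2.
by apply: contrapT => ne; apply: h; exists f, g.
Qed.
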